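(* Let $v=(v_1,v_2,v_3):\mathbb{R}^3\to\mathbb{R}^3$ and $p:\mathbb{R}^3\to\mathbb{R}$ be smooth functions solving the stationary Navier-Stokes equations $$v\cdot\nabla v=-\nabla p+\Delta v,\qquad \nabla\cdot v=0\qquad\text{in }\mathbb{R}^3,$$ and suppose that $v(x)\to 0$ uniformly as $|x|\to+\infty$ and $\int_{\mathbb{R}^3}|\nabla v|^2\,dx<+\infty$. Let $\bar p=\lim_{|x|\to\infty}p(x)$, let $Q=\frac12|v|^2+p-\bar p$ be the (normalized) head pressure, let $m=\inf_{x\in\mathbb{R}^3}Q(x)$, and let $\omega=\nabla\times v$. Then for every integer $k\ge 0$, $$\lim_{\lambda\to 0^+}\bigl(\log_{k+1}(1/\lambda)\bigr)^{-1}\int_{\{x\in\mathbb{R}^3:\,|Q(x)|>\lambda\}}\frac{|\nabla Q|^2}{|Q|\prod_{j=0}^{k}\log_j\!\left(\frac{e_k|m|}{|Q|}\right)}\,dx=\int_{\mathbb{R}^3}|\omega|^2\,dx .$$ Consequently, if there exists an integer $k\ge 0$ such that $$\int_{\{x\in\mathbb{R}^3:\,|Q(x)|>\lambda\}}\frac{|\nabla Q|^2}{|Q|\prod_{j=0}^{k}\log_j\!\left(\frac{e_k|m|}{|Q|}\right)}\,dx=o\bigl(\log_{k+1}(1/\lambda)\bigr)\qquad\text{as }\lambda\to 0^+,$$ then $v=0$ on $\mathbb{R}^3$.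
   Context: Notation. For an integer $k\ge1$, $\exp_k$ and $\log_k$ denote the $k$-fold iterated exponential and $k$-fold iterated natural logarithm: $\exp_k(x)=\exp(\exp(\cdots(\exp x)\cdots))$ and $\log_k(x)=\log(\log(\cdots(\log x)\cdots))$ ($k$ times each). Put $e_k:=\exp_k(1)$ for $k\ge 1$ and $e_0:=1$. By convention $\log_0(x):=1$ for all $x$ (so the $j=0$ factor in the product equals $1$). The quantity $\log_{k+1}(1/\lambda)$ is considered for $\lambda>0$ small enough that it is defined and positive. Also $|\nabla v|^2=\sum_{i,j}|\partial_i v_j|^2$. Normalization of the pressure: it is a known fact that, under the stated hypotheses (decay of $v$ at infinity and finite Dirichlet integral), $p(x)$ converges to a constant $\bar p$ as $|x|\to\infty$. The head pressure is normalized by subtracting this constant, so $Q(x)\to0$ as $|x|\to\infty$. If $Q\equiv 0$, the set $\{|Q|>\lambda\}$ is empty and the integral over it is $0$. *)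

(* Defs.v *)
From HB Require Import structures.
From mathcomp Require Import all_boot all_order all_algebra.
From mathcomp Require Import all_classical all_reals all_analysis.

Set Implicit Arguments.
Unset Strict Implicit.
Unset Printing Implicit Defensive.

Import Order.TTheory GRing.Theory Num.Theory.
Import numFieldNormedType.Exports.

Local Open Scope classical_set_scope.
Local Open Scope ring_scope.

(* R^3 is 'rV[R]_3, and the coordinates x_1, x_2, x_3 of x : 'rV[R]_3 are
   x 0 0, x 0 1 and x 0 2. *)

Section Space.
Context {R : realType}.

Definition vec3 (a b c : R) : 'rV[R]_3 := \row_(i < 3) [:: a; b; c]`_i.

(* The norm provided by the library on 'rV[R]_3 is the sup norm, whence this
   explicit Euclidean one. *)
Definition sqnorm (x : 'rV[R]_3) : R := \sum_i x 0 i ^+ 2.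

Definition enorm (x : 'rV[R]_3) : R := Num.sqrt (sqnorm x).

(* The filter |x| -> +oo on R^3. *)
Definition at_infty : set_system 'rV[R]_3 :=
  filter_from [set: R] (fun M => [set x | M < enorm x]).

(* The library has no measurable structure on 'rV[R]_3: Lebesgue measure on
   R^3 lives on the product R * R * R, identified with 'rV[R]_3 by vec3. *)
Definition lebesgue_measure3 :=
  ((@lebesgue_measure R \x @lebesgue_measure R) \x @lebesgue_measure R)%E.

Definition vec3_of (t : measurableTypeR R * measurableTypeR R * measurableTypeR R)
  : 'rV[R]_3 := vec3 t.1.1 t.1.2 t.2.

Definition integral3 (A : set 'rV[R]_3) (f : 'rV[R]_3 -> R) : \bar R :=
  (\int[lebesgue_measure3]_(t in vec3_of @^-1` A) (f (vec3_of t))%:E)%E.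

End Space.

Section Differential_operators.
Context {R : realType}.
Implicit Types (f p : 'rV[R]_3 -> R) (v : 'rV[R]_3 -> 'rV[R]_3).

Definition partial (i : 'I_3) f (x : 'rV[R]_3) : R := 'D_(delta_mx 0 i) f x.

Definition component v (j : 'I_3) (x : 'rV[R]_3) : R := v x 0 j.

Fixpoint Cn (n : nat) f : Prop :=
  continuous f /\
  if n is n'.+1 then
    forall i : 'I_3,
      (forall x : 'rV[R]_3, derivable f x (delta_mx 0 i)) /\ Cn n' (partial i f)
  else True.

Definition smooth f : Prop := forall n, Cn n f.

Definition smooth_field v : Prop := forall j, smooth (component v j).

Definition grad f (x : 'rV[R]_3) : 'rV[R]_3 := \row_i partial i f x.

Definition laplacian f (x : 'rV[R]_3) : R := \sum_i partial i (partial i f) x.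

Definition divergence v (x : 'rV[R]_3) : R := \sum_i partial i (component v i) x.

Definition curl v (x : 'rV[R]_3) : 'rV[R]_3 :=
  vec3 (partial 1 (component v 2) x - partial 2 (component v 1) x)
       (partial 2 (component v 0) x - partial 0 (component v 2) x)
       (partial 0 (component v 1) x - partial 1 (component v 0) x).

Definition sqnorm_grad v (x : 'rV[R]_3) : R :=
  \sum_i \sum_j partial i (component v j) x ^+ 2.

Definition stationary_navier_stokes v p : Prop :=
  (forall x (j : 'I_3),
     \sum_i v x 0 i * partial i (component v j) x =
     - partial j p x + laplacian (component v j) x) /\
  (forall x, divergence v x = 0).

Definition head_pressure v p (pbar : R) (x : 'rV[R]_3) : R :=
  2^-1 * sqnorm (v x) + p x - pbar.

End Differential_operators.

Section Iterated_logarithms.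
Context {R : realType}.

(* log_0 is the constant 1, not the identity. *)
Definition iterlog (j : nat) (x : R) : R :=
  if j is 0%N then 1 else iter j (@ln R) x.

Definition tower (k : nat) : R := iter k expR 1.

Definition level_integral (k : nat) (Q : 'rV[R]_3 -> R) (lambda : R) : \bar R :=
  let m := inf (range Q) in
  integral3 [set x | lambda < `|Q x|]
    (fun x => sqnorm (grad Q x) /
      (`|Q x| * \prod_(0 <= j < k.+1) iterlog j (tower k * `|m| / `|Q x|))).

End Iterated_logarithms.

(* Main.v *)
Require Import Defs.
From HB Require Import structures.
From mathcomp Require Import all_boot all_order all_algebra.
From mathcomp Require Import all_classical all_reals all_analysis.
From mathcomp Require Import ring lra measurable_realfun.

Import Order.TTheory GRing.Theory Num.Theory.
Import numFieldNormedType.Exports.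

Local Open Scope classical_set_scope.
Local Open Scope ring_scope.

(* The head pressure satisfies [Delta Q - v . grad Q = |omega|^2], so [Q <= 0]
   by the maximum principle, and [omega = 0] wherever [Q = 0] since [Q] is
   maximal there. For [lam > 0] and [P = - Q], the equation tested against
   [h(P)], with [h] vanishing on ]-oo, lam], gives
     int h'(P) |grad P|^2 = int h(P) |omega|^2,
   the transport term being the divergence of the compactly supported field
   [H(P) v] with [H' = h]. Taking [h(s) = L(lam) - L(s)] for [s > lam], where
   [L(s) = log_{k+1}(e_k m / s)], turns the left-hand side into the integral over
   {|Q| > lam}; divided by [log_{k+1}(1 / lam)] the right-hand side tends to
   [int |omega|^2] by dominated convergence. If the limit is zero then [v] is
   curl free and divergence free, so its components are harmonic and vanish at
   infinity. *)

(** * Functions of class C^n *)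

(** [Cn] speaks only of derivatives along the axes, so differential arguments are run on lines
    parallel to an axis, and integration by parts is a Fubini reduction to such lines. Decay of [Q]
    confines {|Q| >= lam} to a box, so no boundary term appears. Two defects keep h(s) = L(lam) -
    L(s) from being a test function on the whole line. It has a corner at [lam], removed by the
    smoothing [spos] and a passage to the limit by monotone convergence. And iterated logarithms
    leave their domain for large [s]; but P <= m, so only s <= m matters, and there the constant e_k
    gives log_j(e_k m / s) >= e_{k-j} >= 1 for 1 <= j <= k, so that the weight may be altered beyond
    [m]. In the limit, the factor e_k m is invisible to iterated logarithms: L(lam) / log_{k+1}(1 /
    lam) tends to 1. Hence the quotients are eventually dominated by 2 |omega|^2, which is
    integrable because |omega|^2 <= 2 |grad v|^2. Points with Q = 0 lie in no level set, so the
    limit there is right only because omega vanishes. *)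

Lemma derive_line_expr (R : realType) (V : normedModType R) (f : V -> R) x v (t : R) :
  (fun h : R => h^-1 *: (((fun s : R => f (x + s *: v)) \o shift t) (h *: (1 : R)) -
    f (x + t *: v))) =
  (fun h : R => h^-1 *: ((f \o shift (x + t *: v)) (h *: v) - f (x + t *: v))).
Proof.
apply/funext => h /=; congr (_ *: (f _ - _)).
by rewrite [h *: 1]mulr1 scalerDl addrCA addrA.
Qed.

Lemma is_derive_line (R : realType) (V : normedModType R) (f : V -> R) x v (t : R) d :
  is_derive (x + t *: v) v f d ->
  is_derive t (1 : R) (fun s : R => f (x + s *: v)) d.
Proof.
move=> [df <-]; apply: DeriveDef.
  by rewrite /derivable derive_line_expr.
by rewrite /derive derive_line_expr.
Qed.

Lemma is_derive_of_line (R : realType) (V : normedModType R) (f : V -> R) x v d :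
  is_derive 0 (1 : R) (fun s : R => f (x + s *: v)) d -> is_derive x v f d.
Proof.
move=> [+ <-]; rewrite /derivable /derive.
have := derive_line_expr R V f x v 0; rewrite scale0r addr0 => -> ?.
exact: DeriveDef.
Qed.

(** Only a directional derivative of [P] is given, so the chain rule passes through the restriction
    of [P] to a line, where the one-variable rule applies. *)
Lemma is_derive_comp1 (R : realType) (V : normedModType R) (h : R -> R) (P : V -> R)
    x v a b :
  is_derive (P x) (1 : R) h a -> is_derive x v P b ->
  is_derive x v (h \o P) (a * b).
Proof.
move=> hP dP; apply: is_derive_of_line.
have dl : is_derive 0 (1 : R) (fun s : R => P (x + s *: v)) b.
  by apply: is_derive_line; rewrite scale0r addr0.
have := @is_derive1_comp R h (fun s : R => P (x + s *: v)) 0 a b.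
by apply => //; rewrite scale0r addr0.
Qed.

Section Cn_calculus.
Context {R : realType}.
Implicit Types f g : 'rV[R]_3 -> R.

Lemma Cn_continuous n f : Cn n f -> continuous f.
Proof. by case: n => [|n] []. Qed.

Lemma Cn_derivable n f i x : Cn n.+1 f -> derivable f x (delta_mx 0 i).
Proof. by move=> [_ /(_ i)[]]. Qed.

Lemma Cn_is_derive n f i x : Cn n.+1 f -> is_derive x (delta_mx 0 i) f (partial i f x).
Proof. by move=> /Cn_derivable cf; exact: derivableP. Qed.

Lemma Cn_partial n f i : Cn n.+1 f -> Cn n (partial i f).
Proof. by move=> [_ /(_ i)[]]. Qed.

Lemma CnW n f : Cn n.+1 f -> Cn n f.
Proof.
elim: n f => [|n IH] f; first by move=> /Cn_continuous.
move=> cf; split; first exact: Cn_continuous cf.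
move=> i; split; first by move=> x; exact: Cn_derivable cf.
by apply: IH; exact: Cn_partial.
Qed.

Lemma Cn_ler m n f : (m <= n)%N -> Cn n f -> Cn m f.
Proof.
by move=> /subnK <-; elim: (n - m)%N => [//|k IH]; rewrite addSn => /CnW.
Qed.

Lemma partial_cst i (c : R) : partial i (cst c) = cst 0.
Proof. by apply/funext => x; rewrite /partial derive_cst. Qed.

Lemma Cn_cst n (c : R) : Cn n (cst c).
Proof.
elim: n c => [|n IH] c.
  split; [exact: cst_continuous|exact: I].
split; first by exact: cst_continuous.
by move=> i; split=> [x|]; [exact: derivable_cst|rewrite partial_cst].
Qed.

Lemma partialD i f g : Cn 1 f -> Cn 1 g ->
  partial i (f + g) = partial i f + partial i g.
Proof.
move=> cf cg; apply/funext => x.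
by rewrite /partial deriveD; [|exact: Cn_derivable cf|exact: Cn_derivable cg].
Qed.

Lemma partialM i f g : Cn 1 f -> Cn 1 g ->
  partial i (f * g) = f * partial i g + g * partial i f.
Proof.
move=> cf cg; apply/funext => x.
by rewrite /partial deriveM; [|exact: Cn_derivable cf|exact: Cn_derivable cg].
Qed.

Lemma CnD n f g : Cn n f -> Cn n g -> Cn n (f + g).
Proof.
elim: n f g => [|n IH] f g cf cg.
  split; [move=> x|exact: I]; exact: cvgD (Cn_continuous _ _ cf x) (Cn_continuous _ _ cg x).
split; first by move=> x; exact: cvgD (Cn_continuous _ _ cf x) (Cn_continuous _ _ cg x).
move=> i; split.
  by move=> x; apply: derivableD; apply: Cn_derivable; eassumption.
rewrite partialD; [|exact: Cn_ler cf|exact: Cn_ler cg].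
by apply: IH; exact: Cn_partial.
Qed.

Lemma CnM n f g : Cn n f -> Cn n g -> Cn n (f * g).
Proof.
elim: n f g => [|n IH] f g cf cg.
  split; [move=> x|exact: I]; exact: cvgM (Cn_continuous _ _ cf x) (Cn_continuous _ _ cg x).
split; first by move=> x; exact: cvgM (Cn_continuous _ _ cf x) (Cn_continuous _ _ cg x).
move=> i; split.
  by move=> x; apply: derivableM; apply: Cn_derivable; eassumption.
rewrite partialM; [|exact: Cn_ler cf|exact: Cn_ler cg].
by apply: CnD; apply: IH; (exact: Cn_partial || exact: CnW).
Qed.

Lemma partialN i f : Cn 1 f -> partial i (- f) = - partial i f.
Proof.
move=> cf; apply/funext => x.
by rewrite /partial deriveN; [|exact: Cn_derivable cf].
Qed.

Lemma CnN n f : Cn n f -> Cn n (- f).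
Proof.
move=> cf; have -> : - f = cst (-1) * f by apply/funext => x /=; rewrite mulN1r.
by apply: CnM => //; exact: Cn_cst.
Qed.

Lemma partial_sum (I : Type) (r : seq I) (F : I -> 'rV[R]_3 -> R) i :
  (forall j, Cn 1 (F j)) ->
  partial i (\sum_(j <- r) F j) = \sum_(j <- r) partial i (F j).
Proof.
move=> cF; elim: r => [|a r IH].
  by rewrite !big_nil; exact: partial_cst.
rewrite !big_cons partialD ?IH //.
elim: r {IH} => [|b r IH]; first by rewrite big_nil; exact: Cn_cst.
by rewrite big_cons; exact: CnD.
Qed.

Lemma Cn_sum n (I : Type) (r : seq I) (F : I -> 'rV[R]_3 -> R) :
  (forall j, Cn n (F j)) -> Cn n (\sum_(j <- r) F j).
Proof.
move=> cF; elim: r => [|a r IH].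
  by rewrite !big_nil; exact: Cn_cst.
by rewrite big_cons; exact: CnD.
Qed.

Lemma MVT_line f i x (t : R) : Cn 1 f -> 0 < t ->
  exists2 c, 0 < c < t &
    f (x + t *: delta_mx 0 i) - f x = partial i f (x + c *: delta_mx 0 i) * t.
Proof.
move=> cf t0.
have df s : is_derive s (1 : R) (fun s : R => f (x + s *: delta_mx 0 i))
    (partial i f (x + s *: delta_mx 0 i)).
  exact: is_derive_line (Cn_is_derive 0 _ _ _ _).
have [|c cab] := @MVT R (fun s : R => f (x + s *: delta_mx 0 i))
  (fun s => partial i f (x + s *: delta_mx 0 i)) 0 t t0.
  apply: continuous_subspaceT => s; apply: differentiable_continuous.
  by apply/derivable1_diffP; case: (df s).
by rewrite scale0r addr0 subr0 => ->; exists c => //; rewrite (itvP cab).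
Qed.

(* The second difference of f over a small square with sides along the axes
   i and j is, by two applications of the mean value theorem, either iterated
   derivative at a nearby point times the area. *)
Lemma second_difference f i j x (t : R) : Cn 2 f -> 0 < t ->
  exists c : R * R, [/\ 0 < c.1 < t, 0 < c.2 < t &
    f (x + t *: delta_mx 0 i + t *: delta_mx 0 j) - f (x + t *: delta_mx 0 i)
      - (f (x + t *: delta_mx 0 j) - f x) =
    partial j (partial i f) (x + c.1 *: delta_mx 0 i + c.2 *: delta_mx 0 j) * t * t].
Proof.
move=> cf t0.
pose g y := f (y + t *: delta_mx 0 j) - f y.
have cf1 := CnW _ _ cf.
have dg s : is_derive s (1 : R) (fun s : R => g (x + s *: delta_mx 0 i))
    (partial i f (x + t *: delta_mx 0 j + s *: delta_mx 0 i) -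
     partial i f (x + s *: delta_mx 0 i)).
  apply: is_deriveB; last exact: is_derive_line (Cn_is_derive 0 _ _ _ _).
  have -> : (fun s : R => f (x + s *: delta_mx 0 i + t *: delta_mx 0 j)) =
            (fun s : R => f (x + t *: delta_mx 0 j + s *: delta_mx 0 i)).
    by apply/funext => u; rewrite addrAC.
  exact: is_derive_line (Cn_is_derive 0 _ _ _ _).
have [|c cab] := @MVT R (fun s : R => g (x + s *: delta_mx 0 i)) _ 0 t t0.
  apply: continuous_subspaceT => s; apply: differentiable_continuous.
  by apply/derivable1_diffP; case: (dg s).
rewrite scale0r addr0 subr0 /g => ->.
have [d dt] := MVT_line (partial i f) j (x + c *: delta_mx 0 i) t (Cn_partial _ _ _ cf) t0.
rewrite addrAC => ->; exists (c, d); split => //=; by rewrite (itvP cab).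
Qed.

Lemma near_double_line f i j x (e : R) : continuous f -> 0 < e ->
  exists2 t : R, 0 < t & forall a b, 0 < a < t -> 0 < b < t ->
    `|f x - f (x + a *: delta_mx 0 i + b *: delta_mx 0 j)| < e.
Proof.
move=> cf e0.
have /cvgrPdist_lt /(_ e e0) := cf x.
move=> /nbhs_normP [d /= d0 dP].
have D k : `|delta_mx 0 k : 'rV[R]_3| <= 1.
  rewrite /Num.norm /= mx_normrE; apply/bigmax_leP; split => // [[a b]] _ /=.
  by rewrite mxE; case: (_ && _); rewrite ?normr1 ?normr0.
(* The unit rows have sup norm at most 1, so two displacements below [d / 2] stay in the ball of
   radius [d]. *)
exists (d / 2); first by rewrite divr_gt0.
move=> a b /andP[a0 ad] /andP[b0 bd]; apply: dP => /=.
rewrite -addrA opprD addNKr normrN.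
apply: (le_lt_trans (ler_normD _ _)); rewrite !normrZ !gtr0_norm //.
rewrite [ltRHS]splitr; apply: ltrD.
  by apply: le_lt_trans ad; rewrite ler_piMr // ltW.
by apply: le_lt_trans bd; rewrite ler_piMr // ltW.
Qed.

(** The second difference is unchanged when [i] and [j] are exchanged, so the two mixed derivatives
    agree at two points of a small square at [x]; by continuity each is within [e / 2] of its value
    at [x]. *)
Theorem partialC f i j x : Cn 2 f ->
  partial i (partial j f) x = partial j (partial i f) x.
Proof.
move=> cf; apply/eqP; rewrite -subr_eq0 -normr_le0; apply/ler_addgt0Pl => e e0.
rewrite addr0.
have cij a b : continuous (partial a (partial b f)).
  exact: (Cn_continuous 0 _ (Cn_partial _ _ _ (Cn_partial _ _ _ cf))).
have e20 : 0 < e / 2 by rewrite divr_gt0.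
have [t t0 Ht] := near_double_line _ j i x (e / 2) (cij i j) e20.
have [s s0 Hs] := near_double_line _ i j x (e / 2) (cij j i) e20.
pose r := Num.min t s.
have r0 : 0 < r by rewrite lt_min t0.
have [c [c1 c2 cE]] := second_difference _ i j x r cf r0.
have [d [d1 d2 dE]] := second_difference _ j i x r cf r0.
have W u w (z : R) : 0 < z < r -> r <= w -> w = u -> 0 < z < u.
  by move=> /andP[-> zr] rw <-; rewrite (lt_le_trans zr).
have rt : r <= t by rewrite ge_min lexx.
have rs : r <= s by rewrite ge_min lexx orbT.
have {Hs} := Hs _ _ (W s s _ c1 rs erefl) (W s s _ c2 rs erefl).
have {Ht} := Ht _ _ (W t t _ d1 rt erefl) (W t t _ d2 rt erefl).
have -> : partial i (partial j f) (x + d.1 *: delta_mx 0 j + d.2 *: delta_mx 0 i) =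
          partial j (partial i f) (x + c.1 *: delta_mx 0 i + c.2 *: delta_mx 0 j).
  apply: (mulIf (lt0r_neq0 r0)); apply: (mulIf (lt0r_neq0 r0)).
  apply: (etrans (esym dE)); apply: (etrans _ cE).
  rewrite (addrAC x (r *: delta_mx 0 j)).
  have swap (a b c' d' : R) : a - b - (c' - d') = a - c' - (b - d') by ring.
  exact: swap.
set A := partial i _ x; set B := partial j _ x; set C := partial j _ _ => H1 H2.
have -> : A - B = (A - C) - (B - C) by ring.
apply: ltW; apply: (le_lt_trans (ler_normB _ _)); rewrite [ltRHS]splitr.
exact: ltrD H1 H2.
Qed.

End Cn_calculus.

(** * Measurability and integrability on R^3 *)

Section Coordinates.
Context {R : realType}.

Local Notation T3 :=
  (measurableTypeR R * measurableTypeR R * measurableTypeR R)%type.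

Definition tcoord (j : 'I_3) (t : T3) : R := vec3_of t 0 j.

Lemma vec3E (a b c : R) (j : 'I_3) : vec3 a b c 0 j = [:: a; b; c]`_j.
Proof. by rewrite mxE. Qed.

Lemma ord3P (j : 'I_3) : [\/ j = 0, j = 1 | j = 2].
Proof.
case: j => [[|[|[|//]]] h]; [apply: Or31|apply: Or32|apply: Or33]; exact/val_inj.
Qed.

Lemma tcoord0 t : tcoord 0 t = t.1.1. Proof. by rewrite /tcoord vec3E. Qed.
Lemma tcoord1 t : tcoord 1 t = t.1.2. Proof. by rewrite /tcoord vec3E. Qed.
Lemma tcoord2 t : tcoord 2 t = t.2. Proof. by rewrite /tcoord vec3E. Qed.

Lemma measurable_tcoord j : measurable_fun setT (tcoord j).
Proof.
have [->|->|->] := ord3P j.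
- rewrite (_ : tcoord 0 = fst \o fst); last by apply/funext => t; rewrite tcoord0.
  by apply: measurableT_comp; exact: measurable_fst.
- rewrite (_ : tcoord 1 = snd \o fst); last by apply/funext => t; rewrite tcoord1.
  by apply: measurableT_comp; [exact: measurable_snd|exact: measurable_fst].
- rewrite (_ : tcoord 2 = snd); last by apply/funext => t; rewrite tcoord2.
  exact: measurable_snd.
Qed.

Lemma norm_rV3_lt (x : 'rV[R]_3) (e : R) : 0 < e ->
  (forall j, `|x 0 j| < e) -> `|x| < e.
Proof.
move=> e0 H; rewrite /Num.norm /= mx_normrE; apply/bigmax_ltP; split=> // [[a b]] _ /=.
by rewrite ord1.
Qed.

Lemma norm_rV3_ge (x : 'rV[R]_3) j : `|x 0 j| <= `|x|.
Proof.
rewrite [leRHS]/Num.norm /= mx_normrE; apply/bigmax_geP; right => /=.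
by exists (0, j).
Qed.

(** Open cubes with rational centre and radius 1 / (n + 1): a countable base of the topology, which
    links it to the sigma-algebra of the product. *)
Definition ratbox (c : rat * rat * rat * nat) : set 'rV[R]_3 :=
  [set x | forall j : 'I_3,
    `|x 0 j - ratr [:: c.1.1.1; c.1.1.2; c.1.2]`_j| < c.2.+1%:R^-1].

Lemma measurable_ratbox c : measurable (vec3_of @^-1` ratbox c : set T3).
Proof.
rewrite (_ : _ @^-1` _ = \bigcap_(j : 'I_3)
   (tcoord j) @^-1` (ball (ratr [:: c.1.1.1; c.1.1.2; c.1.2]`_j : R) c.2.+1%:R^-1)).
  apply: fin_bigcap_measurable => [|j _]; first exact: finite_finset.
  rewrite -[X in measurable X]setTI; apply: measurable_tcoord => //.
  by apply: open_measurable; apply: ball_open; rewrite invr_gt0.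
apply/seteqP; split => t /= H j; first by move=> _; rewrite /ball /= distrC; exact: H.
by have := H j I; rewrite /ball /= distrC.
Qed.

(** The union runs over all codes, with the empty set in place of a cube that leaves [U], so that
    its index type is countable. *)
Lemma open_ratbox (U : set 'rV[R]_3) : open U ->
  U = \bigcup_c (if `[< ratbox c `<=` U >] then ratbox c else set0).
Proof.
move=> oU; apply/seteqP; split => [x Ux|x [c _]]; last first.
  by case: asboolP => // cU /cU.
have /nbhs_normP [d /= d0 dU] := open_nbhs_nbhs (conj oU Ux).
(* A cube of radius below [d / 2] that contains [x] lies in the ball of radius [d] at [x]. *)
have [n nd] : exists n, (n.+1%:R^-1 : R) < d / 2.
  have d2 : 0 < d / 2 by rewrite divr_gt0.
  have [N _ /(_ N (leqnn N)) /= H] := near_infty_natSinv_lt (PosNum d2).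
  by exists N.
have qex (j : 'I_3) : exists q : rat, `|x 0 j - ratr q| < n.+1%:R^-1.
  have lt : x 0 j < x 0 j + n.+1%:R^-1 by rewrite ltrDl invr_gt0.
  have [q] := rat_in_itvoo lt; rewrite in_itv /= => /andP[q1 q2].
  by exists q; rewrite distrC ger0_norm ?subr_ge0 1?ltW // ltrBlDl.
have [q0 h0] := qex 0; have [q1 h1] := qex 1; have [q2 h2] := qex 2.
exists (q0, q1, q2, n) => //.
have xb : ratbox (q0, q1, q2, n) x by move=> j; have [->|->|->] := ord3P j.
rewrite ifT //; apply/asboolP => y yb; apply: dU => /=.
apply: norm_rV3_lt => // j; rewrite !mxE.
have := ltrD (xb j) (yb j); rewrite -[X in _ < X]/(_ + _)%R => H.
rewrite [X in _ < X]splitr.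
apply: (le_lt_trans _ (lt_trans H (ltrD nd nd))).
apply: le_trans (ler_normB _ _).
by rewrite opprB addrA subrK.
Qed.

Lemma measurable_open3 (U : set 'rV[R]_3) : open U ->
  measurable (vec3_of @^-1` U : set T3).
Proof.
move=> /open_ratbox ->; rewrite preimage_bigcup.
apply: countable_bigcupT_measurable => // c.
by case: asboolP => _; [exact: measurable_ratbox|rewrite preimage_set0].
Qed.

Lemma continuous_measurable3 (f : 'rV[R]_3 -> R) : continuous f ->
  measurable_fun setT (f \o vec3_of : T3 -> R).
Proof.
move=> /continuousP cf; apply: (measurability _ (RGenOpens.measurableE R)).
move=> _ [_ [a [b ->] <-]]; rewrite setTI.
by rewrite comp_preimage; apply: measurable_open3; exact/cf/interval_open.
Qed.

(** For [0 <= M] this is the closed ball of the sup norm; the coordinatewise form makes its preimage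
    under [vec3_of] a product of intervals. *)
Definition box (M : R) : set 'rV[R]_3 := [set x | forall j, `|x 0 j| <= M].

Lemma box_norm M x : 0 <= M -> box M x <-> `|x| <= M.
Proof.
move=> M0; split => [H|H j]; last exact: le_trans (norm_rV3_ge _ _) H.
rewrite /Num.norm /= mx_normrE; apply/bigmax_leP; split=> // [[a b]] _ /=.
by rewrite ord1.
Qed.

Lemma box_compact (M : R) : 0 <= M -> compact (box M).
Proof.
move=> M0; rewrite (_ : box M = closed_ball_ Num.norm 0 M); last first.
  apply/seteqP; split => x; rewrite /closed_ball_ /= sub0r normrN; by move/box_norm; apply.
apply: bounded_closed_compact; last exact: closed_closed_ball_.
exists M; split; first exact: num_real.
move=> N MN x; rewrite /closed_ball_ /= sub0r normrN => xM.
by rewrite (le_trans xM) // ltW.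
Qed.

Lemma continuous_bounded_box (f : 'rV[R]_3 -> R) (M : R) : continuous f -> 0 <= M ->
  exists C : R, forall x, box M x -> `|f x| <= C.
Proof.
move=> cf M0.
have [||c _ H] := @EVT_max_rV R 3 (fun x => `|f x|) (box M) _ (box_compact _ M0).
- by exists 0 => j; rewrite mxE normr0.
- apply: continuous_subspaceT => x.
  by apply: (@continuous_comp _ _ _ f) => //; [exact: cf|exact: norm_continuous].
by exists `|f c| => x xM; apply: H; rewrite inE.
Qed.

Lemma measurable_box M : measurable (vec3_of @^-1` box M : set T3).
Proof.
rewrite (_ : _ @^-1` _ = \bigcap_(j : 'I_3) (tcoord j) @^-1` (`[- M, M]%classic)).
  apply: fin_bigcap_measurable => [|j _]; first exact: finite_finset.
  by rewrite -[X in measurable X]setTI; apply: measurable_tcoord.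
apply/seteqP; split => t /= H j; first by move=> _; rewrite /= in_itv /= -ler_norml; exact: H.
by have := H j I; rewrite /= in_itv /= -ler_norml.
Qed.

Lemma measure3_box M : (lebesgue_measure3 (vec3_of @^-1` box M : set T3) < +oo)%E.
Proof.
pose J : set (measurableTypeR R) := `[- M, M]%classic.
have mJ : measurable J by exact: measurable_itv.
rewrite (_ : _ @^-1` _ = (J `*` J) `*` J); last first.
  apply/seteqP; split => [t H|t [[t1 t2] t3] j].
    by do ![split]; rewrite /J /= in_itv /= -ler_norml;
      [have := H 0|have := H 1|have := H 2]; rewrite vec3E.
  move: t1 t2 t3; rewrite /J /= !in_itv /= -!ler_norml => t1 t2 t3.
  by have [->|->|->] := ord3P j; rewrite vec3E.
rewrite /lebesgue_measure3 product_measure1E //; last exact: measurableX.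
rewrite [X in (X * _)%E](@product_measure1E _ _ _ _ R lebesgue_measure
  lebesgue_measure J J mJ mJ).
have fJ : (lebesgue_measure J < +oo)%E.
  by rewrite /J lebesgue_measure_itv /=; case: ifPn => // _; rewrite -EFinD ltry.
have nJ : lebesgue_measure J \is a fin_num by rewrite ge0_fin_numE.
by rewrite -ge0_fin_numE ?mule_ge0 // !fin_numM.
Qed.

Definition compact_supported (f : 'rV[R]_3 -> R) :=
  exists2 M : R, 0 <= M & forall x, ~ box M x -> f x = 0.

Lemma integrable_compact_supported (f : 'rV[R]_3 -> R) :
  continuous f -> compact_supported f ->
  (lebesgue_measure3).-integrable [set: T3] (fun t => (f (vec3_of t))%:E).
Proof.
move=> cf [M M0 fM].
have [C HC] := continuous_bounded_box f M cf M0.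
have mf := continuous_measurable3 _ cf.
have := @measurable_bounded_integrable _ _ R lebesgue_measure3 (f \o vec3_of)
  _ (measurable_box M) (measure3_box M) (measurable_funS _ _ mf).
move=> /(_ measurableT (@subsetT _ _)).
have bf : [bounded (f \o vec3_of) t | t in vec3_of @^-1` box M].
  exists C; split; first exact: num_real.
  by move=> N CN t /= tM; rewrite (le_trans _ (ltW CN)) //; exact: HC.
move=> /(_ bf) /(integrable_mkcond _ (measurable_box M)).1.
apply: eq_integrable => // t _.
rewrite patchE; case: ifPn => // /negP tM /=.
by rewrite fM // => xM; apply: tM; rewrite inE.
Qed.

End Coordinates.

(** * Sigma-finiteness of Lebesgue measure on the plane, for Fubini on R^2 x R *)

Section Plane_measure.
Context {R : realType}.
Local Notation mu := (@lebesgue_measure R).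
Local Notation T2 := (measurableTypeR R * measurableTypeR R)%type.
(* A named constant, since the library registers a sigma-finite structure on
   product_measure1 for probability measures only. *)
Definition lebesgue_measure2 : set T2 -> \bar R := (mu \x mu)%E.

HB.instance Definition _ := Measure.on lebesgue_measure2.

Lemma lebesgue_measure2_sigma_finite : sigma_finite setT lebesgue_measure2.
Proof.
pose J n : set (measurableTypeR R) := `[- n%:R, n%:R]%classic.
have mJ n : measurable (J n) by exact: measurable_itv.
exists (fun n => J n `*` J n); last first.
  move=> n; split; first exact: measurableX.
  rewrite [X in (X < _)%E](@product_measure1E _ _ _ _ R mu mu _ _ (mJ n) (mJ n)).
  have nJ : mu (J n) \is a fin_num.
    rewrite ge0_fin_numE // /J lebesgue_measure_itv /=.
    by case: ifPn => // _; rewrite -EFinD ltry.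
  by rewrite -ge0_fin_numE ?mule_ge0 // fin_numM.
apply/esym; rewrite -subTset => -[x y] _.
exists (Num.bound `|x| + Num.bound `|y|)%N => //.
have [bx By] := (archi_boundP (normr_ge0 x), archi_boundP (normr_ge0 y)).
split; rewrite /J /= in_itv /= -ler_norml natrD; apply: ltW.
  exact: ltr_wpDr _ bx.
exact: ltr_wpDl _ By.
Qed.

HB.instance Definition _ := Measure_isSigmaFinite.Build _ _ _ lebesgue_measure2
  lebesgue_measure2_sigma_finite.

End Plane_measure.

(** * Primitives and integration by parts *)

Section Real_line.
Context {R : realType}.
Local Notation mu := (@lebesgue_measure R).

Lemma is_derive_continuous (F f : R -> R) :
  (forall x, is_derive x (1 : R) F (f x)) -> continuous F.
Proof.
move=> dF x; apply: differentiable_continuous.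
by apply/derivable1_diffP; case: (dF x).
Qed.

(** Where [F] is locally zero so is [f], and the integral reduces to an interval whose endpoints are
    zeros of [F]. *)
Lemma integral_derive_eq0 (F f : R -> R) (M : R) : 0 <= M ->
  (forall x, is_derive x (1 : R) F (f x)) -> continuous f ->
  (forall x, M < `|x| -> F x = 0) ->
  (\int[mu]_x (f x)%:E = 0)%E.
Proof.
move=> M0 dF cf F0.
have f0 x : M < `|x| -> f x = 0.
  move=> Mx.
  have d0 : is_derive x (1 : R) F 0.
    apply: (@near_eq_is_derive _ _ _ (cst 0)).
    near=> y; rewrite F0 //; near: y.
    have /cvgr_gt := @norm_continuous _ _ x; apply; exact: Mx.
  by rewrite -(@derive_val _ _ _ _ _ _ _ (dF x)) (@derive_val _ _ _ _ _ _ _ d0).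
(* The margin 1 puts both endpoints where [F] vanishes, and keeps the interval nondegenerate when
   [M = 0]. *)
have ab : - (M + 1) < M + 1 by lra.
have := @continuous_FTC2 R f F _ _ ab (continuous_subspaceT cf).
have cF := is_derive_continuous _ _ dF.
have dd : derivable_oo_LRcontinuous F (- (M + 1)) (M + 1).
  split.
  - by move=> x _; case: (dF x).
  - by apply: cvg_at_right_filter; exact: cF.
  - by apply: cvg_at_left_filter; exact: cF.
have Fb : F (M + 1) = 0 by apply: F0; rewrite gtr0_norm; lra.
have Fa : F (- (M + 1)) = 0 by apply: F0; rewrite normrN gtr0_norm; lra.
move=> /(_ dd); rewrite Fa Fb subee // => <-; last first.
  by move=> x _; rewrite derive1E; exact: derive_val.
rewrite [RHS]integral_mkcond; apply: eq_integral => x _.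
rewrite patchE; case: ifPn => // /negP; rewrite inE /= in_itv /= -ler_norml => /negP.
by rewrite -ltNge => H; rewrite f0 //; lra.
Unshelve. all: by end_near. Qed.

(** Since [g] vanishes up to [c], one may integrate from [c - 1]: below [c] the result is locally
    zero, and from [c] on the point is interior to [[c - 1, x + 1]], where the fundamental theorem
    applies. *)
Lemma ex_primitive_half (g : R -> R) (c : R) : continuous g ->
  (forall t, t <= c -> g t = 0) ->
  exists F, (forall t, t <= c -> F t = 0) /\ (forall x, is_derive x (1 : R) F (g x)).
Proof.
move=> cg g0.
pose F x := (\int[mu]_(t in [set` `[c - 1, x]]) (g t))%R.
have F0 t : t <= c -> F t = 0.
  move=> tc; rewrite /F /Rintegral integral0_eq // => x /=.
  by rewrite in_itv /= => /andP[_ xt]; rewrite g0 // (le_trans xt).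
exists F; split => // x; have [xc|xc] := ltP x c.
  rewrite g0; last exact: ltW.
  apply: (@near_eq_is_derive _ _ _ (cst 0)).
  near=> y; rewrite F0 //; apply: ltW; near: y; exact: lt_nbhsl.
have ax : c - 1 < x by lra.
have xu : x < x + 1 by lra.
have ig : mu.-integrable `[c - 1, x + 1] (EFin \o g).
  apply: continuous_compact_integrable; first exact: segment_compact.
  exact: continuous_subspaceT.
have [dF <-] := @continuous_FTC1_closed R g (c - 1) x (x + 1) xu ig ax (cg x).
by rewrite derive1E; apply: derivableP.
Unshelve. all: by end_near. Qed.

(** [f] is the constant [f a] plus its deviations to the right and to the left of [a]. The
    reflection of [x] into [2 * a - x] makes the left deviation vanish up to [a], so the half-line
    case gives both primitives; the reflection also causes the minus sign before [F2]. *)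
Lemma ex_primitive (f : R -> R) (a : R) : continuous f ->
  exists F, F a = 0 /\ forall x, is_derive x (1 : R) F (f x).
Proof.
move=> cf.
have cm : continuous (fun t : R => Num.max t a).
  by move=> t; apply: continuous_max => //; exact: cvg_cst.
have [|t ta|F1 [F1a dF1]] := @ex_primitive_half (fun t => f (Num.max t a) - f a) a.
- move=> t; apply: cvgB; last exact: cvg_cst.
  exact: (@continuous_comp _ _ _ (fun t : R => Num.max t a) f t (cm t) (cf _)).
- by rewrite (max_idPr ta) subrr.
have [|t ta|F2 [F2a dF2]] := @ex_primitive_half (fun t => f (2 * a - Num.max t a) - f a) a.
- move=> t; apply: cvgB; last exact: cvg_cst.
  apply: (@continuous_comp _ _ _ (fun t : R => 2 * a - Num.max t a) f t _ (cf _)).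
  exact: cvgB (cvg_cst _) (cm t).
- by rewrite (max_idPr ta) mulr2n mulrDl mul1r addrK subrr.
exists (fun x => f a * (x - a) + F1 x - F2 (2 * a - x)); split.
  have -> : 2 * a - a = a by ring.
  by rewrite F1a // F2a // subrr mulr0 addr0 subrr.
move=> x.
have dlin : is_derive x (1 : R) (fun x : R => f a * (x - a)) (f a).
  by apply: is_derive_eq; rewrite subr0 [_ *: _]mulr1.
have drefl : is_derive x (1 : R) (fun x : R => F2 (2 * a - x))
    ((f (2 * a - Num.max (2 * a - x) a) - f a) * (0 - 1)).
  by apply: (@is_derive1_comp R F2 (fun x => 2 * a - x)).
have dsum := @is_deriveB _ _ _ _ _ x 1 _ _
  (@is_deriveD _ _ _ _ _ x 1 _ _ dlin (dF1 x)) drefl.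
apply: (is_derive_eq dsum).
rewrite sub0r mulrN1 opprK.
have [xa|xa] := leP x a.
  rewrite (_ : Num.max (2 * a - x) a = 2 * a - x); last by apply/max_idPl; lra.
  rewrite subKr; ring.
rewrite (_ : Num.max (2 * a - x) a = a); last by apply/max_idPr; lra.
have -> : 2 * a - a = a by ring.
ring.
Qed.

End Real_line.

Lemma continuous_line {R : realType} (x v : 'rV[R]_3) :
  continuous (fun t : R => x + t *: v).
Proof.
move=> t; apply: (@cvgD _ _ _ _ _ (cst x) (fun t : R => t *: v)); first exact: cvg_cst.
exact: scalel_continuous.
Qed.

Section Integration_by_parts.
Context {R : realType}.
Local Notation mu := (@lebesgue_measure R).
Local Notation T3 :=
  (measurableTypeR R * measurableTypeR R * measurableTypeR R)%type.

Variables (F f : 'rV[R]_3 -> R) (i : 'I_3).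
Hypothesis dF : forall x, is_derive x (delta_mx 0 i) F (f x).
Hypothesis cf : continuous f.
Hypothesis sF : compact_supported F.

Lemma compact_supported_derive : compact_supported f.
Proof.
have [M M0 FM] := sF; exists M => // x xM.
have [j xj] : exists j, M < `|x 0 j|.
  by apply/not_existsP => H; apply: xM => j; rewrite leNgt; apply/negP.
have d0 : is_derive x (delta_mx 0 i) F 0.
  apply: (@near_eq_is_derive _ _ _ (cst 0)).
  near=> y; rewrite FM // => /(_ j); apply/negP; rewrite -ltNge; near: y.
  have /cvgr_gt := @continuous_comp _ _ _ (fun y : 'rV[R]_3 => y 0 j) Num.norm x
    (@coord_continuous _ _ _ 0 j x) (@norm_continuous _ _ _); apply; exact: xj.
by rewrite -(@derive_val _ _ _ _ _ _ _ (dF x)) (@derive_val _ _ _ _ _ _ _ d0).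
Unshelve. all: by end_near. Qed.

(** The base point has [i]-th coordinate 0, so the parameter [t] is that coordinate and the line
    leaves the support of [F] once [|t|] exceeds [M]. *)
Lemma integral_line_eq0 (x : 'rV[R]_3) : x 0 i = 0 ->
  (\int[mu]_t (f (x + (t : R) *: delta_mx 0 i))%:E = 0)%E.
Proof.
move=> xi0; have [M M0 FM] := sF.
apply: (@integral_derive_eq0 R (fun t => F (x + t *: delta_mx 0 i)) _ M) => //.
- by move=> t; exact: is_derive_line.
- move=> t.
  exact: (@continuous_comp _ _ _ _ f t (continuous_line x _ t) (cf _)).
- move=> t Mt; apply: FM => /(_ i); rewrite !mxE xi0 !eqxx /= mulr1 add0r.
  by apply/negP; rewrite -ltNge.
Qed.

(** Fubini makes the [i]-th variable innermost, where the line integral vanishes. For the third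
    coordinate one exchange is enough; for the other two, almost every horizontal slice is
    integrable, and Fubini is applied again on these slices. *)
Lemma integral3_derive_eq0 :
  (\int[lebesgue_measure3]_(t in [set: T3]) (f (vec3_of t))%:E = 0)%E.
Proof.
pose g (t : T3) := (f (vec3_of t))%:E.
have int3 : lebesgue_measure3.-integrable [set: T3] g :=
  integrable_compact_supported f cf compact_supported_derive.
have E12 := @integral12_prod_meas1 _ _ _ _ R lebesgue_measure2 mu g int3.
have E21 := @integral21_prod_meas1 _ _ _ _ R lebesgue_measure2 mu g int3.
have ae2 := @ae_integrable2 _ _ _ _ R lebesgue_measure2 mu g int3.
have mG := @measurable_fubini_G _ _ _ _ R lebesgue_measure2 mu g int3.
have [i0|i1|i2] := ord3P i; last first.
- refine (etrans (esym E12) _).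
  apply: integral0_eq => -[x y] _.
  rewrite /fubini_F; apply: etrans (integral_line_eq0 (vec3 x y 0) _); last by rewrite i2 vec3E.
  apply: eq_integral => z _; congr ((f _)%:E); apply/rowP => j.
  by rewrite /vec3_of i2; have [->|->|->] := ord3P j; rewrite !mxE /= ?mulr0 ?mulr1 ?addr0 ?add0r.
- refine (etrans (esym E21) _).
  rewrite -(integral0 mu setT); apply: ae_eq_integral => //.
  apply: filterS ae2 => z intz _.
  apply: (etrans (esym (@integral12_prod_meas1 _ _ _ _ R _ _ _ intz))).
  apply: integral0_eq => x _.
  rewrite /fubini_F; apply: etrans (integral_line_eq0 (vec3 x 0 z) _); last by rewrite i1 vec3E.
  apply: eq_integral => y _; congr ((f _)%:E); apply/rowP => j.
  by rewrite /vec3_of i1; have [->|->|->] := ord3P j; rewrite !mxE /= ?mulr0 ?mulr1 ?addr0 ?add0r.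
- refine (etrans (esym E21) _).
  rewrite -(integral0 mu setT); apply: ae_eq_integral => //.
  apply: filterS ae2 => z intz _.
  apply: (etrans (esym (@integral21_prod_meas1 _ _ _ _ R _ _ _ intz))).
  apply: integral0_eq => y _.
  rewrite /fubini_G; apply: etrans (integral_line_eq0 (vec3 0 y z) _); last by rewrite i0 vec3E.
  apply: eq_integral => x _; congr ((f _)%:E); apply/rowP => j.
  by rewrite /vec3_of i0; have [->|->|->] := ord3P j; rewrite !mxE /= ?mulr0 ?mulr1 ?addr0 ?add0r.
Qed.

End Integration_by_parts.

(** * The weak formulation above a level *)

Section Continuity.
Context {R : realType} {T : topologicalType}.
Implicit Types f g : T -> R.

Lemma continuous_add f g : continuous f -> continuous g ->
  continuous (fun x => f x + g x).
Proof. by move=> cf cg x; exact: cvgD (cf x) (cg x). Qed.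

Lemma continuous_sub f g : continuous f -> continuous g ->
  continuous (fun x => f x - g x).
Proof. by move=> cf cg x; exact: cvgB (cf x) (cg x). Qed.

Lemma continuous_mul f g : continuous f -> continuous g ->
  continuous (fun x => f x * g x).
Proof. by move=> cf cg x; exact: cvgM (cf x) (cg x). Qed.

Lemma continuous_maxr f g : continuous f -> continuous g ->
  continuous (fun x => Num.max (f x) (g x)).
Proof. by move=> cf cg x; exact: continuous_max (cf x) (cg x). Qed.

Lemma continuous_comp1 (k : R -> R) f : continuous f -> continuous k ->
  continuous (fun x => k (f x)).
Proof. by move=> cf ck x; exact: (@continuous_comp _ _ _ f k x (cf x) (ck _)). Qed.

Lemma continuous_sum n (F : 'I_n -> T -> R) : (forall i, continuous (F i)) ->
  continuous (fun x => \sum_i F i x).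
Proof.
elim: n F => [|n IH] F cF.
  rewrite (_ : (fun _ => _) = cst 0); first exact: cst_continuous.
  by apply/funext => x; rewrite big_ord0.
rewrite (_ : (fun _ => _) = fun x => F ord0 x + \sum_i F (lift ord0 i) x).
  by apply: continuous_add => //; exact: IH.
by apply/funext => x; rewrite big_ord_recl.
Qed.

End Continuity.

#[global] Instance at_infty_filter {R : realType} : Filter (@at_infty R).
Proof.
apply: filter_from_filter; first by exists 0.
move=> a b _ _; exists (Num.max a b) => // x /=.
by rewrite gt_max => /andP[].
Qed.

(** A coordinate larger than [M] in absolute value forces the Euclidean norm above [M]. This is
    where the compact supports of the test functions come from. *)
Lemma at_infty_box {R : realType} (P : 'rV[R]_3 -> R) (lam : R) :
  P x @[x --> at_infty] --> (0 : R) -> 0 < lam ->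
  exists2 M, 0 <= M & forall x, ~ box M x -> `|P x| < lam.
Proof.
move=> /cvgrPdist_lt /(_ lam) + lam0 => /(_ lam0) [M _ MP].
exists (Num.max M 0); first by rewrite le_max lexx orbT.
move=> x xM; have [j xj] : exists j, Num.max M 0 < `|x 0 j|.
  by apply/not_existsP => H; apply: xM => j; rewrite leNgt; apply/negP.
have := MP x; rewrite /= sub0r normrN; apply.
have : M < `|x 0 j| by apply: le_lt_trans xj; rewrite le_max lexx.
move=> /lt_le_trans; apply.
rewrite -sqrtr_sqr /enorm ler_sqrt; last first.
  by rewrite /sqnorm sumr_ge0 // => i _; exact: sqr_ge0.
by rewrite /sqnorm (bigD1 j) //= lerDl sumr_ge0 // => i _; exact: sqr_ge0.
Qed.

Section Nonnegative_integral.
Context {R : realType}.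
Local Notation T3 :=
  (measurableTypeR R * measurableTypeR R * measurableTypeR R)%type.

Local Notation mu := (@lebesgue_measure R).

(** A positive value would persist on a sup-norm ball, a product of three intervals of length 2d
    with measure (2d)^3 > 0, whereas [f] vanishes off a null set. *)
Lemma continuous_integral3_eq0 (f : 'rV[R]_3 -> R) : continuous f ->
  (forall x, 0 <= f x) -> integral3 setT f = 0%E -> forall x, f x = 0.
Proof.
move=> cf f0 If x; apply/eqP; apply/negPn/negP => fx.
have mf : measurable_fun [set: T3] (fun t => (f (vec3_of t))%:E).
  by apply/measurable_EFinP; exact: continuous_measurable3.
have [|N [mN N0 fN]] := (ae_eq_integral_abs lebesgue_measure3 measurableT mf).1.
  rewrite -[RHS]If; apply: eq_integral => t _; by rewrite gee0_abs // lee_fin.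
have fx0 : 0 < f x by rewrite lt_neqAle eq_sym fx f0.
have : \forall y \near x, 0 < f y by have /cvgr_gt := cf x; apply.
move=> /nbhs_normP [d /= d0 dP].
pose B j : set (measurableTypeR R) := ball (x 0 j) d.
have mB j : measurable (B j) by apply: open_measurable; exact: ball_open.
have BN : (B 0 `*` B 1) `*` B 2 `<=` N.
  move=> t [[t0 t1] t2]; apply: fN => /= /(_ I) [] /eqP; apply/negP.
  rewrite gt_eqF //; apply: dP => /=; apply: norm_rV3_lt => // j.
  by have [->|->|->] := ord3P j; rewrite !mxE /=; rewrite /B /ball /= in t0 t1 t2.
have E : (lebesgue_measure3 ((B 0%R `*` B 1%R) `*` B 2%R) =
    mu (B 0%R) * mu (B 1%R) * mu (B 2%R))%E.
  rewrite /lebesgue_measure3.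
  rewrite [LHS](@product_measure1E _ _ _ _ R lebesgue_measure2 lebesgue_measure _ _
     (measurableX (mB 0) (mB 1)) (mB 2)).
  by rewrite [X in (X * _)%E](@product_measure1E _ _ _ _ R lebesgue_measure
     lebesgue_measure _ _ (mB 0) (mB 1)).
have L j : mu (B j) = (d *+ 2)%:E by rewrite lebesgue_measure_ball // ltW.
have := subset_measure0 (measurableX (measurableX (mB 0) (mB 1)) (mB 2)) mN BN N0.
move=> /(etrans (esym E)); rewrite !L -!EFinM => -[] /eqP.
by rewrite !mulf_eq0 !mulrn_eq0 /= gt_eqF.
Qed.

End Nonnegative_integral.

Section Level_identity.
Context {R : realType}.
Variables (P : 'rV[R]_3 -> R) (w : 'rV[R]_3 -> 'rV[R]_3) (lam : R) (h h' : R -> R).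
Hypothesis cP : Cn 2 P.
Hypothesis cw : forall j, Cn 1 (component w j).
Hypothesis dw : forall x, divergence w x = 0.
Hypothesis P0 : P x @[x --> at_infty] --> (0 : R).
Hypothesis lam0 : 0 < lam.
Hypothesis dh : forall s, is_derive s (1 : R) h (h' s).
Hypothesis ch' : continuous h'.
Hypothesis h0 : forall s, s <= lam -> h s = 0.

Definition drift (x : 'rV[R]_3) := laplacian P x - \sum_i w x 0 i * partial i P x.

Let dP i x : is_derive x (delta_mx 0 i) P (partial i P x).
Proof. exact: Cn_is_derive cP. Qed.

Let cpP i : continuous (partial i P).
Proof. exact: (Cn_continuous _ _ (Cn_partial _ _ _ cP)). Qed.

Let contP : continuous P. Proof. exact: (Cn_continuous _ _ cP). Qed.

Let cppP i : continuous (partial i (partial i P)).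
Proof. exact: (Cn_continuous _ _ (Cn_partial _ _ _ (Cn_partial _ _ _ cP))). Qed.

Let cwj j : continuous (component w j). Proof. exact: (Cn_continuous _ _ (cw j)). Qed.

Let h'0 s : s < lam -> h' s = 0.
Proof.
move=> sl.
have d0 : is_derive s (1 : R) h 0.
  apply: (@near_eq_is_derive _ _ _ (cst 0)).
  near=> y; rewrite h0 //; apply: ltW; near: y; exact: lt_nbhsl.
by rewrite -(@derive_val _ _ _ _ _ _ _ (dh s)) (@derive_val _ _ _ _ _ _ _ d0).
Unshelve. all: by end_near. Qed.

Lemma continuous_sqnorm_grad : continuous (fun x => sqnorm (grad P x)).
Proof.
rewrite (_ : (fun _ => _) = fun x => \sum_i (partial i P x * partial i P x)).
  by apply: continuous_sum => i; exact: continuous_mul.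
by apply/funext => x; apply: eq_bigr => i _; rewrite mxE expr2.
Qed.

Lemma continuous_drift : continuous drift.
Proof.
apply: continuous_sub; first exact: continuous_sum.
by apply: continuous_sum => i; apply: continuous_mul => //; exact: cwj.
Qed.

Lemma compact_supported_level (k : R -> R) (f : 'rV[R]_3 -> R) :
  (forall s, s < lam -> k s = 0) -> compact_supported (fun x => k (P x) * f x).
Proof.
move=> k0; have [M M0 PM] := at_infty_box P lam P0 lam0.
exists M => // x /PM xM; rewrite k0 ?mul0r //.
by apply: le_lt_trans xM; exact: ler_norm.
Qed.

Lemma integrable_level_grad : lebesgue_measure3.-integrable setT
  (fun t => (h' (P (vec3_of t)) * sqnorm (grad P (vec3_of t)))%:E).
Proof.
apply: (integrable_compact_supported (fun x => h' (P x) * sqnorm (grad P x))).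
  by apply: continuous_mul continuous_sqnorm_grad; exact: continuous_comp1.
exact: compact_supported_level.
Qed.

Lemma integrable_level_drift : lebesgue_measure3.-integrable setT
  (fun t => (h (P (vec3_of t)) * drift (vec3_of t))%:E).
Proof.
apply: (integrable_compact_supported (fun x => h (P x) * drift x)).
  apply: continuous_mul continuous_drift; apply: continuous_comp1 => //.
  exact: is_derive_continuous dh.
by apply: compact_supported_level => s /ltW; exact: h0.
Qed.

(* The integrand is the divergence of [h(P) grad P - H(P) w], where [H] is the
   primitive of [h] vanishing on ]-oo, lam]. *)
Theorem level_identity :
  integral3 setT (fun x => h' (P x) * sqnorm (grad P x) + h (P x) * drift x) = 0%E.
Proof.
have ch := is_derive_continuous _ _ dh.
have [H [H0 dH]] := ex_primitive_half h lam ch h0.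
have cH := is_derive_continuous _ _ dH.
pose F i x := h (P x) * partial i P x - w x 0 i * H (P x).
pose f i x := (h (P x) * partial i (partial i P) x +
  partial i P x * (h' (P x) * partial i P x)) -
  (w x 0 i * (h (P x) * partial i P x) + H (P x) * partial i (component w i) x).
have dF i x : is_derive x (delta_mx 0 i) (F i) (f i x).
  apply: is_deriveB.
    apply: (@is_deriveM _ _ (h \o P) (partial i P)).
      exact: is_derive_comp1 (dh _) (dP i x).
    exact: (Cn_is_derive 0 _ _ _ (Cn_partial _ _ _ cP)).
  apply: (@is_deriveM _ _ (component w i) (H \o P)).
    exact: (Cn_is_derive 0 _ _ _ (cw i)).
  exact: is_derive_comp1 (dH _) (dP i x).
have cf i : continuous (f i).
  apply: continuous_sub; apply: continuous_add; apply: continuous_mul.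
  - exact: continuous_comp1.
  - exact: cppP.
  - exact: cpP.
  - by apply: continuous_mul => //; exact: continuous_comp1.
  - exact: cwj.
  - by apply: continuous_mul => //; exact: continuous_comp1.
  - exact: continuous_comp1.
  - exact: (Cn_continuous _ _ (Cn_partial _ _ _ (cw i))).
have sF i : compact_supported (F i).
  have [M M0 PM] := at_infty_box P lam P0 lam0; exists M => // x /PM xM.
  have Pl : P x <= lam by apply: ltW; apply: le_lt_trans xM; exact: ler_norm.
  by rewrite /F h0 // H0 // mul0r mulr0 subr0.
have If i := integral3_derive_eq0 _ _ i (dF i) (cf i) (sF i).
have ig i := integrable_compact_supported _ (cf i)
  (compact_supported_derive _ _ i (dF i) (sF i)).
have := @integral_sum _ _ R lebesgue_measure3 setT measurableT 'I_3
  (fun i t => (f i (vec3_of t))%:E) ig (index_enum 'I_3) xpredT.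
rewrite big1; last by move=> i _; exact: If.
move=> <-; apply: eq_integral => t _; rewrite sumEFin; congr (_%:E).
move: (vec3_of t) => x.
have := dw x; rewrite /divergence /drift /laplacian /sqnorm /f => dwx.
rewrite mulrBr !mulr_sumr.
have -> : \sum_i h' (P x) * grad P x 0 i ^+ 2 =
          \sum_i partial i P x * (h' (P x) * partial i P x).
  by apply: eq_bigr => i _; rewrite mxE expr2 mulrCA.
(* The terms added on the right sum to [H (P x) * divergence w x], which is zero. *)
have -> : \sum_i h (P x) * (w x 0 i * partial i P x) =
          \sum_i (w x 0 i * (h (P x) * partial i P x)
            + H (P x) * partial i (component w i) x).
  rewrite big_split /= -[in RHS]mulr_sumr dwx mulr0 addr0.
  by apply: eq_bigr => i _; rewrite mulrCA.
by rewrite addrA -!big_split /= -sumrB; apply: eq_bigr => i _; rewrite [X in X - _]addrC.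
Qed.

End Level_identity.

(** * The maximum principle *)

Section Subsolution.
Context {R : realType}.
Variables (P : 'rV[R]_3 -> R) (w : 'rV[R]_3 -> 'rV[R]_3).
Hypothesis cP : Cn 2 P.
Hypothesis cw : forall j, Cn 1 (component w j).
Hypothesis dw : forall x, divergence w x = 0.
Hypothesis P0 : P x @[x --> at_infty] --> (0 : R).

Lemma sqnorm_ge0 (x : 'rV[R]_3) : 0 <= sqnorm x.
Proof. by rewrite /sqnorm sumr_ge0 // => i _; exact: sqr_ge0. Qed.

Lemma sqnorm_eq0 (x : 'rV[R]_3) : sqnorm x = 0 -> x = 0.
Proof.
move=> /eqP; rewrite psumr_eq0; last by move=> i _; exact: sqr_ge0.
by move=> /allP H; apply/rowP => i; rewrite mxE; apply/eqP;
  rewrite -sqrf_eq0; apply: (H i); rewrite mem_index_enum.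
Qed.

(* Testing against [h(P)] with [h(s) = (s - lam)_+^2 / 2] shows that [h(P)] has
   zero gradient, hence vanishes, as it does far away. *)
Theorem subsolution_le0 : (forall x, 0 <= drift P w x) -> forall x, P x <= 0.
Proof.
move=> sub x; apply/ler_addgt0Pl => lam lam0; rewrite addr0.
pose k (s : R) := Num.max (s - lam) 0.
have ck : continuous k.
  apply: continuous_maxr; last exact: cst_continuous.
  by apply: continuous_sub; [move=> s; exact: cvg_id|exact: cst_continuous].
have k0 s : s <= lam -> k s = 0 by move=> sl; apply/max_idPr; rewrite subr_le0.
have [h [h0 dh]] := ex_primitive_half k lam ck k0.
have kge0 s : 0 <= k s by rewrite le_max lexx orbT.
have h_gt s : lam < s -> 0 < h s.
  move=> ls.
  have [|c cab] := @MVT R h k lam s ls.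
    exact/continuous_subspaceT/(is_derive_continuous _ _ dh).
  rewrite (h0 lam) // subr0 => ->; rewrite mulr_gt0 ?subr_gt0 // lt_max subr_gt0.
  by rewrite (itvP cab).
have hge0 s : 0 <= h s by have [/h0->//|/h_gt/ltW] := leP s lam.
have Ih := level_identity P w lam h k cP cw dw P0 lam0 dh ck h0.
have Z := continuous_integral3_eq0 _ _ _ Ih.
have {}Z y : k (P y) * sqnorm (grad P y) + h (P y) * drift P w y = 0.
  apply: Z => [|z]; last first.
    by apply: addr_ge0; apply: mulr_ge0 => //; exact: sqnorm_ge0.
  have cPc := Cn_continuous _ _ cP.
  apply: continuous_add; apply: continuous_mul.
  - exact: continuous_comp1.
  - exact: continuous_sqnorm_grad.
  - by apply: continuous_comp1 => //; exact: is_derive_continuous dh.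
  - exact: continuous_drift.
(* One axis suffices: [h \o P] is constant along it, and the line leaves every box. *)
have kd y : k (P y) * partial 0 P y = 0.
  move/eqP: (Z y); rewrite paddr_eq0; last 2 first.
  - by apply: mulr_ge0 => //; exact: sqnorm_ge0.
  - exact: mulr_ge0.
  move=> /andP[+ _]; rewrite mulf_eq0 => /orP[/eqP->|/eqP/sqnorm_eq0 g0].
    by rewrite mul0r.
  by move/rowP: g0 => /(_ 0); rewrite !mxE => ->; rewrite mulr0.
have [M M0 PM] := at_infty_box P lam P0 lam0.
have cst t : h (P (x + 0 *: delta_mx 0 0)) = h (P (x + t *: delta_mx 0 0)).
  apply: (@is_derive_0_is_cst R (fun t => h (P (x + t *: delta_mx 0 0)))) => s.
  apply: (@is_derive_line _ _ (h \o P)); rewrite -(kd (x + s *: delta_mx 0 0)).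
  exact: is_derive_comp1 (dh _) (Cn_is_derive 1 _ _ _ cP).
rewrite leNgt; apply/negP => /h_gt; apply/negP; rewrite -leNgt.
rewrite -[P x](congr1 P (addr0 x)) -(scale0r (delta_mx 0 0)).
(* This displacement brings the first coordinate to [M + 1], outside the box. *)
rewrite (cst (M + 1 - x 0 0)) h0 //; apply: ltW; apply: (le_lt_trans (ler_norm _)).
apply: PM => /(_ 0); rewrite !mxE /= mulr1 addrC subrK ger0_norm; lra.
Qed.

End Subsolution.

(** * The energy above a level *)

Section Smoothed_positive_part.
Context {R : realType}.

(* A C^1 approximation of the positive part, increasing to it as e -> 0. *)
Definition spos (e t : R) : R := Num.max t 0 ^+ 2 / (Num.max t 0 + e).

(** The derivative of [spos e]: for t > 0, t^2 / (t + e) = t - e + e^2 / (t + e), and for t <= 0 the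
    formula gives 1 - 1 = 0. *)
Definition dspos (e t : R) : R := 1 - (e / (Num.max t 0 + e)) ^+ 2.

Lemma spos_le0 e t : t <= 0 -> spos e t = 0.
Proof. by move=> t0; rewrite /spos (max_idPr t0) expr0n mul0r. Qed.

Lemma dspos_le0 e t : 0 < e -> t <= 0 -> dspos e t = 0.
Proof.
by move=> e0 t0; rewrite /dspos (max_idPr t0) add0r divff ?gt_eqF // expr1n subrr.
Qed.

Lemma spos_gt0 e t : 0 < t -> spos e t = t ^+ 2 / (t + e).
Proof. by move=> /ltW t0; rewrite /spos (max_idPl t0). Qed.

Lemma dspos_gt0 e t : 0 < t -> dspos e t = 1 - (e / (t + e)) ^+ 2.
Proof. by move=> /ltW t0; rewrite /dspos (max_idPl t0). Qed.

Lemma continuous_dspos e : 0 < e -> continuous (dspos e).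
Proof.
move=> e0.
have cm : continuous (fun t : R => Num.max t 0 + e).
  apply: continuous_add; last exact: cst_continuous.
  by apply: continuous_maxr; [move=> t; exact: cvg_id|exact: cst_continuous].
have ci : continuous (fun t : R => e / (Num.max t 0 + e)).
  move=> t; apply: cvgM; first exact: cvg_cst.
  apply: cvgV; last exact: cm.
  by rewrite gt_eqF // ltr_wpDl // le_max lexx orbT.
by apply: continuous_sub; [exact: cst_continuous|exact: continuous_mul].
Qed.

(** The difference quotient at 0 is bounded by [C * |h|]. This settles the point where the two
    branches of [spos] meet. *)
Lemma is_derive_quadratic (f : R -> R) (C : R) :
  (forall t, `|f t| <= C * t ^+ 2) -> is_derive 0 (1 : R) f 0.
Proof.
move=> fC.
have f0 : f 0 = 0.
  by apply/eqP; rewrite -normr_le0 (le_trans (fC 0)) // expr0n mulr0.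
have L : h^-1 *: ((f \o shift 0) (h *: (1 : R)) - f 0) @[h --> 0^'] --> (0 : R).
  have cC : (C * `|h| @[h --> (0 : R)^']) --> (0 : R).
    rewrite -[X in _ --> X](mulr0 C) -[X in _ * X](normr0 R).
    apply: cvg_within_filter; apply: cvgM; first exact: cvg_cst.
    exact: norm_continuous.
  apply/norm_cvg0P.
  apply: (squeeze_cvgr _ (cvg_cst (0 : R)) cC).
  near=> h.
  have h0 : h != 0 by near: h; exact: nbhs_dnbhs_neq.
  rewrite normr_ge0 /= f0 subr0 [h *: 1]mulr1 addr0 normrM normfV.
  rewrite ler_pdivrMl ?normr_gt0 // mulrCA -expr2 real_normK ?num_real //.
apply: DeriveDef; first by apply: cvgP; exact: L.
exact: (cvg_lim (@Rhausdorff R) L).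
Unshelve. all: by end_near. Qed.

Lemma is_derive_spos e t : 0 < e -> is_derive t (1 : R) (spos e) (dspos e t).
Proof.
move=> e0; have [t0|t0|->] := ltgtP t 0.
- rewrite dspos_le0 ?ltW //; apply: (@near_eq_is_derive _ _ _ (cst 0)).
  near=> y; rewrite spos_le0 //; apply: ltW; near: y; exact: lt_nbhsl.
- apply: (@near_eq_is_derive _ _ _ (fun t : R => t ^+ 2 * (t + e)^-1)).
    near=> y; rewrite spos_gt0 //; near: y; exact: lt_nbhsr.
  have te : t + e != 0 by rewrite gt_eqF // addr_gt0.
  have d1 : is_derive t (1 : R) (fun t : R => t + e) (1 + 0) by apply: is_deriveD.
  have dV : is_derive t (1 : R) (fun t : R => (t + e)^-1) (- (t + e) ^- 2 *: (1 + 0)).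
    by apply: DeriveDef; [exact: derivableV|rewrite deriveV // derive_val].
  have dX : is_derive t (1 : R) (fun t : R => t ^+ 2) (2%:R * t).
    by apply: is_derive_eq; rewrite !scaler1 mulr_natl.
  apply: (is_derive_eq (@is_deriveM _ _ _ _ _ _ _ _ dX dV)).
  rewrite dspos_gt0 // addr0 /GRing.scale /=; field; exact: te.
(* For t > 0, t^2 / (t + e) <= t^2 / e, whence the constant. *)
- rewrite dspos_le0 //; apply: (@is_derive_quadratic _ e^-1) => y.
  have [y0|y0] := leP y 0; first by rewrite spos_le0 // normr0 mulr_ge0 ?sqr_ge0 // invr_ge0 ltW.
  rewrite spos_gt0 // ger0_norm; last by apply: divr_ge0; [exact: sqr_ge0|lra].
  rewrite mulrC ler_wpM2r ?sqr_ge0 // lef_pV2 ?posrE //; lra.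
Unshelve. all: by end_near. Qed.

Lemma spos_ge0 e t : 0 < e -> 0 <= spos e t.
Proof.
move=> e0; have m0 : 0 <= Num.max t 0 by rewrite le_max lexx orbT.
by apply: divr_ge0; [exact: sqr_ge0|lra].
Qed.

Lemma spos_nincr e e' t : 0 < e' -> e' <= e -> spos e t <= spos e' t.
Proof.
move=> e0 ee; have m0 : 0 <= Num.max t 0 by rewrite le_max lexx orbT.
rewrite /spos ler_wpM2l ?sqr_ge0 // lef_pV2 ?posrE; lra.
Qed.

Lemma dspos_nincr e e' t : 0 < e' -> e' <= e -> dspos e t <= dspos e' t.
Proof.
move=> e0 ee; have m0 : 0 <= Num.max t 0 by rewrite le_max lexx orbT.
have e1 : 0 < e by exact: lt_le_trans ee.
rewrite /dspos lerD2l lerN2 lerXn2r ?nnegrE ?divr_ge0 ?addr_ge0 ?(ltW e0) ?(ltW e1) //.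
rewrite ler_pdivrMr; last lra.
rewrite mulrAC ler_pdivlMr; last lra.
nra.
Qed.

Lemma dspos_ge0 e t : 0 < e -> 0 <= dspos e t.
Proof.
move=> e0; have m0 : 0 <= Num.max t 0 by rewrite le_max lexx orbT.
rewrite /dspos subr_ge0 expr_le1 ?divr_ge0 ?addr_ge0 ?(ltW e0) //.
rewrite ler_pdivrMr; lra.
Qed.

Lemma cvg_spos t : spos n.+1%:R^-1 t @[n --> \oo] --> Num.max t 0.
Proof.
have [t0|t0] := leP t 0.
  rewrite (_ : (fun _ => _) = cst 0); first exact: cvg_cst.
  by apply/funext => n; rewrite spos_le0.
rewrite (_ : (fun _ => _) = fun n => t ^+ 2 / (t + n.+1%:R^-1)); last first.
  by apply/funext => n; rewrite spos_gt0.
have E : t ^+ 2 / (t + 0) = t by rewrite addr0 expr2 mulfK // gt_eqF.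
rewrite -[X in _ --> X]E.
apply: cvgM; first exact: cvg_cst.
apply: cvgV; first by rewrite addr0 gt_eqF.
apply: cvgD; first exact: cvg_cst.
exact: cvg_harmonic.
Qed.

(** At [t = 0] every term is 0, so the limit is the indicator of the strict inequality, matching the
    strict level set {P > lam}. *)
Lemma cvg_dspos t : dspos n.+1%:R^-1 t @[n --> \oo] --> (if 0 < t then 1 else 0 : R).
Proof.
case: ifPn => [t0|]; last first.
  rewrite -leNgt => t0; rewrite (_ : (fun _ => _) = cst 0); first exact: cvg_cst.
  by apply/funext => n; rewrite dspos_le0.
rewrite (_ : (fun _ => _) = fun n =>
    1 - (n.+1%:R^-1 / (t + n.+1%:R^-1)) * (n.+1%:R^-1 / (t + n.+1%:R^-1))); last first.
  by apply/funext => n; rewrite dspos_gt0 // expr2.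
have q : n.+1%:R^-1 / (t + n.+1%:R^-1) @[n --> \oo] --> (0 / (t + 0) : R).
  apply: cvgM; first exact: cvg_harmonic.
  apply: cvgV; first by rewrite addr0 gt_eqF.
  by apply: cvgD; [exact: cvg_cst|exact: cvg_harmonic].
rewrite mul0r in q.
have L : 1 - 0 * 0 = 1 :> R by rewrite mul0r subr0.
rewrite -[X in _ --> X]L; exact: cvgB (cvg_cst _) (cvgM q q).
Qed.

End Smoothed_positive_part.

Lemma cvg_integral3_monotone {R : realType} (a : nat -> 'rV[R]_3 -> R) (b : 'rV[R]_3 -> R) :
  (forall n, continuous (a n)) -> (forall n x, 0 <= a n x) ->
  (forall x, nondecreasing_seq (a ^~ x)) ->
  (forall x, a n x @[n --> \oo] --> b x) ->
  integral3 setT (a n) @[n --> \oo] --> integral3 setT b.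
Proof.
move=> ca a0 nda ab.
have ma n : measurable_fun setT (fun t => (a n (vec3_of t))%:E).
  by apply/measurable_EFinP; exact: continuous_measurable3.
have := @cvg_monotone_convergence _ _ R lebesgue_measure3 setT measurableT
  (fun n t => (a n (vec3_of t))%:E) ma.
rewrite /integral3 preimage_setT.
move=> /(_ _ _); have -> : (fun t => limn (fun n => (a n (vec3_of t))%:E)) =
    (fun t => (b (vec3_of t))%:E).
  apply/funext => t; apply/cvg_lim => //.
  by apply: cvg_EFin; [exact: nearW|exact: ab].
apply.
- by move=> n t _; rewrite lee_fin.
- by move=> t _ m n mn; rewrite lee_fin; exact: nda.
Qed.

Section Level_energy.
Context {R : realType}.
Variables (P g : 'rV[R]_3 -> R) (w : 'rV[R]_3 -> 'rV[R]_3) (lam : R) (phi G : R -> R).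
Hypothesis cP : Cn 2 P.
Hypothesis cw : forall j, Cn 1 (component w j).
Hypothesis dw : forall x, divergence w x = 0.
Hypothesis P0 : P x @[x --> at_infty] --> (0 : R).
Hypothesis lam0 : 0 < lam.
Hypothesis cphi : continuous phi.
Hypothesis phi0 : forall s, 0 < phi s.
Hypothesis dG : forall s, is_derive s (1 : R) G (phi s).
Hypothesis G0 : G lam = 0.
Hypothesis dPg : forall x, drift P w x = - g x.
Hypothesis g0 : forall x, 0 <= g x.

Lemma primitive_incr s t : s < t -> G s < G t.
Proof.
move=> st; have [|c cab] := @MVT R G phi s t st.
  exact/continuous_subspaceT/(is_derive_continuous _ _ dG).
by move=> H; rewrite -subr_gt0 H mulr_gt0 // subr_gt0.
Qed.

Lemma primitive_gt0 s : (0 < G s) = (lam < s).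
Proof.
apply/idP/idP => [|/primitive_incr]; last by rewrite G0.
by rewrite -G0; apply: contraTT; rewrite -!leNgt le_eqVlt => /orP[/eqP->//|/primitive_incr/ltW].
Qed.

Let cPc : continuous P. Proof. exact: (Cn_continuous _ _ cP). Qed.
Let cG : continuous G. Proof. exact: is_derive_continuous dG. Qed.

Let cg : continuous g.
Proof.
rewrite (_ : g = fun x => 0 - drift P w x).
  by apply: continuous_sub; [exact: cst_continuous|exact: continuous_drift].
by apply/funext => x; rewrite dPg sub0r opprK.
Qed.

Let A e x := dspos e (G (P x)) * phi (P x) * sqnorm (grad P x).
Let B e x := spos e (G (P x)) * g x.

(** The function [spos e \o G] is C^1 and vanishes up to [lam], as [level_identity] requires. *)
Lemma smoothed_level_energy e : 0 < e -> integral3 setT (A e) = integral3 setT (B e).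
Proof.
move=> e0.
pose h s := spos e (G s); pose h' s := dspos e (G s) * phi s.
have dh s : is_derive s (1 : R) h (h' s).
  exact: is_derive1_comp (is_derive_spos e _ e0) (dG s).
have ch' : continuous h'.
  apply: continuous_mul => //; apply: continuous_comp1 => //.
  exact: continuous_dspos.
have h0 s : s <= lam -> h s = 0.
  by move=> sl; apply: spos_le0; rewrite leNgt primitive_gt0 -leNgt.
have := level_identity P w lam h h' cP cw dw P0 lam0 dh ch' h0.
have iA := integrable_level_grad P lam h h' cP P0 lam0 dh ch' h0.
have iB := integrable_level_drift P w lam h h' cP cw P0 lam0 dh h0.
rewrite /integral3 preimage_setT => I0.
have I1 := @integralD_EFin _ _ R lebesgue_measure3 setT measurableT _ _ iA iB.
have I2 : (\int[lebesgue_measure3]_t (h (P (vec3_of t)) * drift P w (vec3_of t))%:E =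
   - \int[lebesgue_measure3]_t (B e (vec3_of t))%:E)%E.
  rewrite -integral_ge0N; last first.
    by move=> t _; rewrite lee_fin mulr_ge0 // spos_ge0.
  by apply: eq_integral => t _; rewrite dPg mulrN.
(* Finiteness allows the drift term to change sides in the extended reals. *)
have fB : (\int[lebesgue_measure3]_t (B e (vec3_of t))%:E \is a fin_num)%E.
  rewrite -fin_numN -I2; exact: integrable_fin_num iB.
rewrite -[LHS](subeK _ fB) -I2 -[RHS]add0e; congr (_ + _)%E.
by rewrite -[RHS]I0; exact/esym.
Qed.

Let C x := (if lam < P x then phi (P x) else 0) * sqnorm (grad P x).

(** The positive part of [G] has a corner at [lam] and is no C^1 test function. With e = 1 / (n + 1)
    both sides of the smoothed identity increase to their limits, so monotone convergence gives
    equality in the extended reals. *)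
Theorem level_energy :
  integral3 [set x | lam < P x] (fun x => phi (P x) * sqnorm (grad P x)) =
  integral3 setT (fun x => Num.max (G (P x)) 0 * g x).
Proof.
have en n : 0 < n.+1%:R^-1 :> R by rewrite invr_gt0.
have nde m n : (m <= n)%N -> n.+1%:R^-1 <= m.+1%:R^-1 :> R.
  by move=> mn; rewrite lef_pV2 ?posrE // ler_nat.
have LA : integral3 setT (A n.+1%:R^-1) @[n --> \oo] --> integral3 setT C.
  apply: cvg_integral3_monotone.
  - move=> n; apply: continuous_mul; last exact: continuous_sqnorm_grad.
    apply: continuous_mul; last exact: continuous_comp1.
    apply: continuous_comp1; first exact: continuous_comp1.
    exact: continuous_dspos.
  - move=> n x; rewrite mulr_ge0 ?sqnorm_ge0 // mulr_ge0 ?dspos_ge0 //.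
    exact: ltW.
  - move=> x m n mn; rewrite ler_wpM2r ?sqnorm_ge0 // ler_wpM2r ?(ltW (phi0 _)) //.
    by rewrite dspos_nincr // nde.
  - move=> x; apply: cvgM; last exact: cvg_cst.
    have -> : (if lam < P x then phi (P x) else 0) =
        (if 0 < G (P x) then 1 else 0) * phi (P x).
      by rewrite primitive_gt0; case: ifP; rewrite ?mul1r ?mul0r.
    by apply: cvgM; [exact: cvg_dspos|exact: cvg_cst].
have LB : integral3 setT (B n.+1%:R^-1) @[n --> \oo] -->
    integral3 setT (fun x => Num.max (G (P x)) 0 * g x).
  apply: cvg_integral3_monotone.
  - move=> n; apply: continuous_mul; last exact: cg.
    apply: continuous_comp1; first exact: continuous_comp1.
    by apply: is_derive_continuous => s; exact: is_derive_spos.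
  - by move=> n x; rewrite mulr_ge0 // spos_ge0.
  - by move=> x m n mn; rewrite ler_wpM2r // spos_nincr // nde.
  - by move=> x; apply: cvgM; [exact: cvg_spos|exact: cvg_cst].
have EAB : (fun n => integral3 setT (A n.+1%:R^-1)) =
           (fun n => integral3 setT (B n.+1%:R^-1)).
  by apply/funext => n; exact: smoothed_level_energy.
rewrite EAB in LA.
rewrite -(cvg_unique _ LA LB) // /integral3 integral_mkcond preimage_setT.
apply: eq_integral => t _; rewrite patchE /C.
case: ifPn => [|/negP tl]; first by rewrite inE /= => ->.
by rewrite ifF ?mul0r //; apply/negP => H; apply: tl; rewrite inE.
Qed.

End Level_energy.

Local Opaque partial Cn.

(** * The equation of the head pressure *)

Lemma sum_ord3 (V : zmodType) (F : 'I_3 -> V) : \sum_i F i = F 0 + F 1 + F 2.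
Proof.
rewrite !big_ord_recl big_ord0 addr0 addrA.
by congr (_ + _ + _); congr (F _); exact/val_inj.
Qed.

Section Differential_identities.
Context {R : realType}.
Implicit Types (P Q : 'rV[R]_3 -> R).

Lemma driftN P (w : 'rV[R]_3 -> 'rV[R]_3) x : Cn 2 P -> drift (- P) w x = - drift P w x.
Proof.
move=> cP; have cP1 := CnW _ _ cP.
have pN i : partial i (- P) = - partial i P by exact: partialN.
rewrite /drift /laplacian opprB [RHS]addrC; congr (_ + _).
  rewrite -sumrN; apply: eq_bigr => i _; rewrite pN.
  by rewrite (partialN _ _ (Cn_partial _ _ _ cP)).
by rewrite -sumrN; apply: eq_bigr => i _; rewrite pN mulrN opprK.
Qed.

Lemma sqnorm_gradN P x : Cn 1 P -> sqnorm (grad (- P) x) = sqnorm (grad P x).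
Proof.
move=> cP; apply: eq_bigr => i _; rewrite !mxE partialN //.
by rewrite [(- partial i P) x]/(- partial i P x) sqrrN.
Qed.

(** A positive second derivative at [x] would stay positive nearby; then the first derivative, zero
    at [x], becomes positive along the axis, and [P] rises above [P x]. Each step is one mean value
    theorem. *)
Lemma partial_max i P x : Cn 2 P -> (forall y, P y <= P x) ->
  partial i P x = 0 /\ partial i (partial i P) x <= 0.
Proof.
move=> cP Pmax; pose e : 'rV[R]_3 := delta_mx 0 i.
have cP1 := CnW _ _ cP.
have dP t : is_derive t (1 : R) (fun s : R => P (x + s *: e)) (partial i P (x + t *: e)).
  exact: is_derive_line (Cn_is_derive 0 _ _ _ cP1).
have p0 : partial i P x = 0.
  have : is_derive 0 (1 : R) (fun s : R => P (x + s *: e)) 0.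
    apply: (@derive1_at_max R _ (-1) 1 0); first lra.
    - by move=> t _; case: (dP t).
    - by rewrite in_itv /=; lra.
    - by move=> t _; rewrite scale0r addr0.
  move=> d0; have := @derive_val _ _ _ _ _ _ _ (dP 0).
  by rewrite (@derive_val _ _ _ _ _ _ _ d0) scale0r addr0.
split => //; rewrite leNgt; apply/negP => pp.
have cpp : continuous (partial i (partial i P)).
  exact: (Cn_continuous _ _ (Cn_partial _ _ _ (Cn_partial _ _ _ cP))).
have : \forall y \near x, 0 < partial i (partial i P) y by have /cvgr_gt := cpp x; apply.
move=> /nbhs_normP [d /= d0 dP0].
have d20 : 0 < d / 2 by rewrite divr_gt0.
have [c /andP[c0 cd] cE] := MVT_line P i x _ cP1 d20.
have [b /andP[b0 bc] bE] := MVT_line (partial i P) i x _ (Cn_partial _ _ _ cP) c0.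
have e1 : `|e| <= 1.
  rewrite /Num.norm /= mx_normrE; apply/bigmax_leP; split => // [[k l]] _ /=.
  by rewrite mxE; case: (_ && _); rewrite ?normr1 ?normr0.
have ppb : 0 < partial i (partial i P) (x + b *: e).
  apply: dP0; rewrite /= opprD addNKr normrN normrZ gtr0_norm //.
  apply: (@le_lt_trans _ _ b); first by rewrite ler_piMr // ltW.
  by rewrite (lt_trans bc) // (lt_trans cd) // ltr_pdivrMr // ltr_pMr // ltr1n.
have pc : 0 < partial i P (x + c *: e).
  have := mulr_gt0 ppb c0; rewrite -[X in 0 < X -> _]bE.
  by move: p0; move: (partial i P x) => u ->; rewrite subr0.
have := mulr_gt0 pc d20; rewrite -[X in 0 < X -> _]cE subr_gt0 ltNge.
by move=> /negP; apply.
Qed.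

Lemma drift_max_le0 P (w : 'rV[R]_3 -> 'rV[R]_3) x : Cn 2 P ->
  (forall y, P y <= P x) -> drift P w x <= 0.
Proof.
move=> cP Pmax; have H i := partial_max i P x cP Pmax.
rewrite /drift [X in _ - X]big1 ?subr0; last by move=> i _; rewrite (H i).1 mulr0.
by apply: sumr_le0 => i _; exact: (H i).2.
Qed.

End Differential_identities.

(** * Identities for the velocity, the pressure and the head pressure *)

Section Navier_Stokes.
Context {R : realType}.
Variables (v : 'rV[R]_3 -> 'rV[R]_3) (p : 'rV[R]_3 -> R) (pbar : R).
Hypothesis v_smooth : smooth_field v.
Hypothesis p_smooth : smooth p.
Hypothesis div0 : forall x, divergence v x = 0.

Let cv n j : Cn n (component v j). Proof. exact: v_smooth. Qed.

Let cpv n i j : Cn n (partial i (component v j)).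
Proof. by apply: Cn_partial; exact: cv. Qed.

Let cppv n i j k : Cn n (partial i (partial j (component v k))).
Proof. by apply: Cn_partial; exact: cpv. Qed.

Lemma partial_divergence i x : \sum_j partial i (partial j (component v j)) x = 0.
Proof.
have D : \sum_j partial j (component v j) = cst 0.
  by apply/funext => y; rewrite fct_sumE; exact: div0.
transitivity ((\sum_j partial i (partial j (component v j))) x).
  by rewrite fct_sumE.
by rewrite -partial_sum // D partial_cst.
Qed.

(** Since partial derivatives commute, this is the Laplacian of the divergence. *)
Lemma divergence_laplacian x :
  \sum_j \sum_i partial j (partial i (partial i (component v j))) x = 0.
Proof.
have D i : \sum_j partial i (partial j (component v j)) = cst 0.
  by apply/funext => y; rewrite fct_sumE; exact: partial_divergence.
rewrite exchange_big /=; apply: big1 => i _.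
rewrite (eq_bigr (fun j => partial i (partial i (partial j (component v j))) x)); last first.
  move=> j _; apply: (etrans (partialC (partial i (component v j)) j i x (cpv 2 i j))).
  have -> : partial j (partial i (component v j)) = partial i (partial j (component v j)).
    by apply/funext => y; exact: (partialC (component v j) j i y (cv 2 j)).
  by [].
transitivity ((\sum_j partial i (partial i (partial j (component v j)))) x).
  by rewrite fct_sumE.
by rewrite -partial_sum // D partial_cst.
Qed.

(** Zero curl makes the Jacobian symmetric, so d_i d_i v_j = d_i d_j v_i = d_j d_i v_i, whose sum
    over [i] is the [j]-th derivative of the divergence. *)
Lemma curl_free_laplacian j x : (forall y, curl v y = 0) ->
  laplacian (component v j) x = 0.
Proof.
move=> curl0.
have sym a b y : partial a (component v b) y = partial b (component v a) y.
  move/rowP: (curl0 y) => H.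
  have := H 0; have := H 1; have := H 2; rewrite !vec3E !mxE /=.
  move=> /subr0_eq h2 /subr0_eq h1 /subr0_eq h0.
  by have [->|->|->] := ord3P a; have [->|->|->] := ord3P b;
    [exact: erefl|exact: h2|exact: esym h1|exact: esym h2|exact: erefl|exact: h0
    |exact: h1|exact: esym h0|exact: erefl].
rewrite /laplacian -[RHS](partial_divergence j x); apply: eq_bigr => i _.
apply: (etrans _ (partialC (component v i) i j x (cv 2 i))).
by have -> : partial i (component v j) = partial j (component v i) by apply/funext => y; exact: sym.
Qed.

(** Bounds [int |omega|^2] by the Dirichlet integral; each component uses (a - b)^2 <= 2 (a^2 +
    b^2). *)
Lemma sqnorm_curl_le x : sqnorm (curl v x) <= 2 * sqnorm_grad v x.
Proof.
rewrite /sqnorm_grad /sqnorm /curl !sum_ord3 !vec3E /=.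
have sq (a b : R) : (a - b) ^+ 2 <= 2 * (a ^+ 2 + b ^+ 2).
  by rewrite -subr_ge0 (_ : _ - _ = (a + b) ^+ 2) ?sqr_ge0 //; ring.
have aux (a b c d e f g h i : R) : (f - h) ^+ 2 + (g - c) ^+ 2 + (b - d) ^+ 2 <=
    2 * (a ^+ 2 + b ^+ 2 + c ^+ 2 + (d ^+ 2 + e ^+ 2 + f ^+ 2)
      + (g ^+ 2 + h ^+ 2 + i ^+ 2)).
  have := sq f h; have := sq g c; have := sq b d.
  have := sqr_ge0 a; have := sqr_ge0 e; have := sqr_ge0 i; lra.
exact: aux.
Qed.

Let Q := head_pressure v p pbar.

(** Written in the ring of functions, [Q] falls under the closure rules of [Cn] and the product and
    sum rules of [partial]. *)
Lemma head_pressureE :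
  Q = cst 2^-1 * \sum_j component v j * component v j + p + cst (- pbar).
Proof.
apply/funext => x; rewrite /Q /head_pressure /sqnorm.
rewrite -[RHS]/(2^-1 * (\sum_j component v j * component v j) x + p x - pbar).
by congr (_ * _ + _ - _); rewrite fct_sumE; apply: eq_bigr => j _; rewrite expr2.
Qed.

Lemma Cn_head_pressure n : Cn n Q.
Proof.
rewrite head_pressureE; apply: CnD; last exact: Cn_cst.
apply: CnD; last exact: p_smooth.
apply: CnM; first exact: Cn_cst.
by apply: Cn_sum => j; apply: CnM; exact: cv.
Qed.

Lemma partial_head_pressure i :
  partial i Q = \sum_j component v j * partial i (component v j) + partial i p.
Proof.
have cvv n : Cn n (\sum_j component v j * component v j).
  by apply: Cn_sum => j; apply: CnM; exact: cv.
have cp1 : Cn 1 p by exact: p_smooth.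
rewrite head_pressureE partialD; [|by apply: CnD => //; apply: CnM => //; exact: Cn_cst|exact: Cn_cst].
rewrite partial_cst partialD //; last by apply: CnM => //; exact: Cn_cst.
rewrite partialM //; last exact: Cn_cst.
rewrite partial_cst partial_sum; last by move=> j; apply: CnM; exact: cv.
apply/funext => x.
rewrite -[LHS]/(2^-1 * (\sum_j partial i (component v j * component v j)) x +
  (\sum_j component v j * component v j) x * 0 + partial i p x + 0).
rewrite -[RHS]/((\sum_j component v j * partial i (component v j)) x + partial i p x).
rewrite mulr0 !addr0 !fct_sumE mulr_sumr; congr (_ + _); apply: eq_bigr => j _.
rewrite partialM //.
rewrite -[X in _ * X]/((component v j) x * partial i (component v j) x + (component v j) x * partial i (component v j) x).
by rewrite -[RHS]/((component v j) x * partial i (component v j) x) -mulr2n -[X in _ * X]mulr_natl mulKf.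
Qed.

Hypothesis momentum : forall x j,
  \sum_i v x 0 i * partial i (component v j) x =
  - partial j p x + laplacian (component v j) x.

(** The divergence of the momentum equation: the viscous term becomes the Laplacian of div v, and
    the second-order part of the transport term becomes v . grad (div v); both vanish. *)
Lemma laplacian_pressure x :
  laplacian p x = - \sum_j \sum_i partial j (component v i) x * partial i (component v j) x.
Proof.
have cp n : Cn n p by exact: p_smooth.
have dp j : partial j p = \sum_i partial i (partial i (component v j)) +
    - \sum_i component v i * partial i (component v j).
  apply/funext => y.
  rewrite -[RHS]/((\sum_i partial i (partial i (component v j))) y -
    (\sum_i component v i * partial i (component v j)) y) !fct_sumE.
  have -> : \sum_i component v i y * partial i (component v j) y =
      - partial j p y + laplacian (component v j) y by exact: momentum.
  by rewrite opprD opprK addrCA subrr addr0.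
rewrite /laplacian.
have E j : partial j (partial j p) x =
    \sum_i partial j (partial i (partial i (component v j))) x -
    (\sum_i v x 0 i * partial i (partial j (component v j)) x
     + \sum_i partial j (component v i) x * partial i (component v j) x).
  have c1 : Cn 1 (\sum_i partial i (partial i (component v j))) by exact: Cn_sum.
  have c2 : Cn 1 (\sum_i component v i * partial i (component v j)).
    by apply: Cn_sum => i; exact: CnM.
  rewrite dp partialD //; last exact: CnN.
  rewrite partialN // !partial_sum //; last by move=> i; exact: CnM.
  rewrite -[LHS]/((\sum_i partial j (partial i (partial i (component v j)))) x -
    (\sum_i partial j (component v i * partial i (component v j))) x) !fct_sumE.
  congr (_ - _); rewrite -big_split; apply: eq_bigr => i _ /=.
  rewrite (partialM j _ _ (cv 1 i) (cpv 1 i j)).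
  have <- := partialC (component v j) j i x (cv 2 j).
  rewrite -[LHS]/(v x 0 i * partial j (partial i (component v j)) x +
    partial i (component v j) x * partial j (component v i) x).
  by congr (_ + _); rewrite mulrC.
rewrite (eq_bigr _ (fun j _ => E j)) sumrB divergence_laplacian sub0r big_split /=.
rewrite exchange_big /= [X in X + _]big1 ?add0r // => i _.
by rewrite -mulr_sumr partial_divergence mulr0.
Qed.

(** Here Delta Q = v . Delta v + |grad v|^2 + Delta p, while the momentum equation multiplied by [v]
    gives v . grad Q = v . Delta v. What remains is |A|^2 - tr(A^2) for the Jacobian A, that is, the
    squares of its antisymmetric differences. *)
Theorem drift_head_pressure x : drift Q v x = sqnorm (curl v x).
Proof.
have cp n : Cn n p by exact: p_smooth.
have ppQ i : partial i (partial i Q) x =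
    \sum_j v x 0 j * partial i (partial i (component v j)) x +
    \sum_j partial i (component v j) x ^+ 2 + partial i (partial i p) x.
  rewrite partial_head_pressure partialD; [|by apply: Cn_sum => j; exact: CnM|exact: Cn_partial (cp 2)].
  rewrite partial_sum; last by move=> j; exact: CnM.
  rewrite -[LHS]/((\sum_j partial i (component v j * partial i (component v j))) x +
    partial i (partial i p) x) fct_sumE -big_split.
  congr (_ + _); apply: eq_bigr => j _ /=.
  by rewrite partialM // expr2.
have vQ : \sum_i v x 0 i * partial i Q x = \sum_j v x 0 j * laplacian (component v j) x.
  transitivity (\sum_j v x 0 j * (\sum_i v x 0 i * partial i (component v j) x + partial j p x)).
    rewrite (eq_bigr (fun i => \sum_j v x 0 i * (v x 0 j * partial i (component v j) x)
        + v x 0 i * partial i p x)).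
      rewrite big_split /= exchange_big /= -big_split /=; apply: eq_bigr => j _.
      rewrite mulrDr mulr_sumr; congr (_ + _); apply: eq_bigr => i _; exact: mulrCA.
    move=> i _; rewrite partial_head_pressure.
    rewrite -[X in _ * X]/((\sum_j component v j * partial i (component v j)) x + partial i p x).
    by rewrite fct_sumE mulrDr mulr_sumr.
  by apply: eq_bigr => j _; rewrite momentum addrAC addNr add0r.
rewrite /drift vQ {1}/laplacian (eq_bigr _ (fun i _ => ppQ i)) !big_split /=.
rewrite -/(laplacian p x) laplacian_pressure.
have -> : \sum_i \sum_j v x 0 j * partial i (partial i (component v j)) x =
    \sum_j v x 0 j * laplacian (component v j) x.
  by rewrite exchange_big; apply: eq_bigr => j _; rewrite /laplacian mulr_sumr.
rewrite -addrA addrC addrK /sqnorm /curl !sum_ord3 !vec3E /=.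
have aux (a b c d e f g h i : R) : a ^+ 2 + b ^+ 2 + c ^+ 2 + (d ^+ 2 + e ^+ 2 + f ^+ 2)
    + (g ^+ 2 + h ^+ 2 + i ^+ 2) -
    (a * a + b * d + c * g + (d * b + e * e + f * h) + (g * c + h * f + i * i)) =
  (f - h) ^+ 2 + (g - c) ^+ 2 + (b - d) ^+ 2 by ring.
exact: (aux (partial 0 (component v 0) x) (partial 0 (component v 1) x) (partial 0 (component v 2) x)
  (partial 1 (component v 0) x) (partial 1 (component v 1) x) (partial 1 (component v 2) x)
  (partial 2 (component v 0) x) (partial 2 (component v 1) x) (partial 2 (component v 2) x)).
Qed.

End Navier_Stokes.

(** * Iterated logarithms *)

Section Asymptotics.
Context {R : realType} {T : Type} (F : set_system T) {FF : ProperFilter F}.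
Implicit Types a b : T -> R.

Lemma cvgy_ln b : b x @[x --> F] --> +oo -> ln (b x) @[x --> F] --> +oo.
Proof.
move=> bF; apply/cvgryPge => A; near=> x.
have bx : expR A <= b x by near: x; move/cvgryPge : bF; exact.
by rewrite -[leLHS]expRK ler_ln ?posrE ?expR_gt0 // (lt_le_trans _ bx) ?expR_gt0.
Unshelve. all: by end_near. Qed.

Lemma cvgy_iter_ln n b : b x @[x --> F] --> +oo -> iter n (@ln R) (b x) @[x --> F] --> +oo.
Proof. by move=> bF; elim: n => //= n; exact: cvgy_ln. Qed.

(** The quotient is 1 + ln(a / b) / ln b, with a convergent numerator and a denominator tending to
    infinity. *)
Lemma cvg_ln_ratio a b (l : R) : 0 < l -> b x @[x --> F] --> +oo ->
  a x / b x @[x --> F] --> l -> ln (a x) / ln (b x) @[x --> F] --> (1 : R).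
Proof.
move=> l0 bF abF.
have lnF := cvgy_ln _ bF.
have ib : (ln (b x))^-1 @[x --> F] --> (0 : R).
  have p : \forall x \near F, 0 < ln (b x).
    by move/cvgryPgt : lnF => /(_ 0).
  exact/(gtr0_cvgV0 p).
have L : ln (a x / b x) * (ln (b x))^-1 + 1 @[x --> F] --> (1 : R).
  have E : ln l * 0 + 1 = 1 :> R by rewrite mulr0 add0r.
  have c1 : ln (a x / b x) @[x --> F] --> ln l.
    exact: continuous_cvg (continuous_ln l0) abF.
  rewrite -[X in _ --> X]E; exact: cvgD (cvgM c1 ib) (cvg_cst _).
apply: cvg_trans L; apply: near_eq_cvg; near=> x.
have b1 : 1 < b x by near: x; move/cvgryPgt : bF; exact.
have ab0 : 0 < a x / b x by near: x; have /cvgr_gt := abF; apply.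
have b0 : 0 < b x by rewrite (lt_trans _ b1).
have a0 : 0 < a x by rewrite -(divfK (lt0r_neq0 b0) (a x)) mulr_gt0.
rewrite ln_div ?posrE // mulrBl mulfV ?subrK //.
by rewrite gt_eqF // ln_gt0.
Unshelve. all: by end_near. Qed.

(** The ratio of the arguments tends to [c]; the first logarithm turns this limit into 1, and the
    later ones preserve it. *)
Lemma cvg_iter_ln_ratio n (c : R) b : 0 < c -> b x @[x --> F] --> +oo ->
  iter n.+1 (@ln R) (c * b x) / iter n.+1 (@ln R) (b x) @[x --> F] --> (1 : R).
Proof.
move=> c0 bF; elim: n => [|n IH]; last first.
  exact: (cvg_ln_ratio _ _ 1 ltr01 (cvgy_iter_ln n.+1 b bF) IH).
apply: (cvg_ln_ratio _ _ c) => //=.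
have cc : (fun _ : T => c) x @[x --> F] --> c by exact: cvg_cst.
apply: cvg_trans cc; apply: near_eq_cvg; near=> x.
rewrite mulfK // gt_eqF //; near: x; by move/cvgryPgt : bF; exact.
Unshelve. all: by end_near. Qed.

End Asymptotics.

(** * Iterated logarithms of e_k m / s for 0 < s <= m *)

Section Iterated_logarithms.
Context {R : realType}.
Variables (k : nat) (m : R).
Hypothesis m0 : 0 < m.

Lemma tower_ge1 n : 1 <= tower n :> R.
Proof.
elim: n => [|n IH]; first by rewrite /tower.
rewrite /tower iterS -/(tower n) (le_trans _ (expR_ge1Dx _)) //.
by rewrite lerDl (le_trans ler01).
Qed.

(* [log_j(e_k m / s)], except that [iln 0 s] is [e_k m / s] while [log_0] is 1. *)
Definition iln (j : nat) (s : R) : R := iter j (@ln R) (tower k * m / s).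

(** Positivity is asked only at [t], where the values are smaller; the induction carries it over to
    [s]. *)
Lemma iln_le j s t : 0 < s -> s <= t -> (forall i, (i < j)%N -> 0 < iln i t) ->
  iln j t <= iln j s.
Proof.
move=> s0 st; elim: j => [|j IH] pos.
  rewrite /iln /= ler_pM2l ?mulr_gt0 ?(lt_le_trans _ (tower_ge1 k)) //.
  by rewrite lef_pV2 ?posrE // (lt_le_trans s0).
have ij : iln j t <= iln j s by apply: IH => i ij; apply: pos; exact: ltnW.
have pj : 0 < iln j t by exact: pos.
by rewrite /iln !iterS ler_ln // posrE // (lt_le_trans pj).
Qed.

(** At [s = m] the argument is e_k, and each logarithm removes one exponential. *)
Lemma iln_top j : (j <= k)%N -> iln j m = tower (k - j).
Proof.
elim: j => [|j IH] jk.
  by rewrite /iln /= mulfK ?gt_eqF // subn0.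
rewrite /iln iterS -/(iln j m) IH ?(ltnW jk) //.
by rewrite -(subnSK jk) /tower iterS expRK.
Qed.

(** This is what the constant e_k is for: the value at [s] is at least the value e_{k-j} at [m]. The
    comparison needs positivity at [m] of all earlier iterates, hence the strong induction. *)
Lemma iln_ge1 j s : 0 < s <= m -> (j <= k)%N -> 1 <= iln j s.
Proof.
elim/ltn_ind : j s => j IH s /andP[s0 sm] jk.
apply: (@le_trans _ _ (iln j m)); first by rewrite iln_top // tower_ge1.
apply: iln_le => // i ij; apply: (@lt_le_trans _ _ 1) => //.
by apply: IH => //; [rewrite m0 lexx|rewrite (leq_trans (ltnW ij))].
Qed.

(** One logarithm further only nonnegativity is left: at [s = m] the value is ln 1 = 0. *)
Lemma iln_last_ge0 s : 0 < s <= m -> 0 <= iln k.+1 s.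
Proof. by move=> sm; rewrite /iln iterS ln_ge0 // iln_ge1. Qed.

(** For [n = k], the denominator of the level integral at |Q| = s; its reciprocal is minus the
    derivative of [iln n.+1]. *)
Definition ilnprod (n : nat) (s : R) : R :=
  s * \prod_(0 <= j < n.+1) iterlog j (tower k * m / s).

Lemma ilnprodS n s : ilnprod n.+1 s = ilnprod n s * iln n.+1 s.
Proof. by rewrite /ilnprod big_nat_recr //= mulrA. Qed.

Lemma ilnprod_gt0 n s : 0 < s <= m -> (n <= k)%N -> 0 < ilnprod n s.
Proof.
move=> /[dup] sm /andP[s0 _]; elim: n => [|n IH] nk.
  by rewrite /ilnprod big_nat1 mulr1.
by rewrite ilnprodS mulr_gt0 ?IH ?(ltnW nk) // (lt_le_trans _ (iln_ge1 _ _ sm nk)).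
Qed.

(** The first logarithm contributes 1 / s, and each further one divides by its argument, so the
    derivative of the iterate [n.+1] collects the factors up to [n]. *)
Lemma is_derive_iln n s : 0 < s <= m -> (n <= k)%N ->
  is_derive s (1 : R) (iln n.+1) (- (ilnprod n s)^-1).
Proof.
move=> /[dup] sm /andP[s0 _]; elim: n => [|n IH] nk.
  have i0 : 0 < tower k * m / s by rewrite divr_gt0 // mulr_gt0 // (lt_le_trans _ (tower_ge1 k)).
  have dV : is_derive s (1 : R) (fun s : R => tower k * m * s^-1)
      (tower k * m *: (- s ^- 2 *: 1)).
    apply: is_deriveZ; apply: DeriveDef; first by apply: derivableV => //; rewrite gt_eqF.
    by rewrite deriveV ?gt_eqF // derive_id.
  have := @is_derive1_comp R (@ln R) (fun s : R => tower k * m * s^-1) s _ _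
    (is_derive1_ln i0) dV.
  rewrite /ilnprod big_nat1 mulr1 => H; apply: (is_derive_eq H).
  rewrite /GRing.scale /=; have := lt0r_neq0 s0; have := lt0r_neq0 i0.
  rewrite mulf_eq0 invr_eq0 negb_or => /andP[tm s1] s2.
  by move: (tower k * m) tm => c c0; field; rewrite c0 s2.
have pn : 0 < iln n.+1 s by rewrite (lt_le_trans _ (iln_ge1 _ _ sm nk)).
have := @is_derive1_comp R (@ln R) (iln n.+1) s _ _ (is_derive1_ln pn) (IH (ltnW nk)).
move=> H; apply: (is_derive_eq H); by rewrite mulrN ilnprodS [in RHS]invfM [in LHS]mulrC.
Qed.

Lemma continuous_ilnprod n s : 0 < s <= m -> (n <= k)%N -> {for s, continuous (ilnprod n)}.
Proof.
move=> sm; elim: n => [|n IH] nk.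
  rewrite (_ : ilnprod 0 = id) //; last first.
    by apply/funext => t; rewrite /ilnprod big_nat1 mulr1.
rewrite (_ : ilnprod n.+1 = (fun t => ilnprod n t * iln n.+1 t)); last first.
  by apply/funext => t; exact: ilnprodS.
apply: cvgM; first exact: IH (ltnW nk).
apply: differentiable_continuous; apply/derivable1_diffP.
by case: (is_derive_iln n s sm (ltnW nk)).
Qed.

(* The weight of the level integral is clamped outside [lam, m], where iterated
   logarithms take junk values. *)
Lemma ex_level_weight lam : 0 < lam <= m ->
  exists phi G : R -> R, [/\ continuous phi, forall s, 0 < phi s,
    forall s, is_derive s (1 : R) G (phi s), G lam = 0 &
    forall s, lam <= s <= m ->
      phi s = (ilnprod k s)^-1 /\ G s = iln k.+1 lam - iln k.+1 s].
Proof.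
move=> /andP[lam0 lamm].
pose clamp (s : R) := Num.max lam (Num.min s m).
have clampP s : 0 < clamp s <= m.
  by rewrite /clamp lt_max lam0 /= ge_max lamm ge_min lexx orbT.
have clampE s : lam <= s <= m -> clamp s = s.
  by move=> /andP[ls sm]; rewrite /clamp (min_idPl sm) (max_idPr ls).
have cclamp : continuous clamp.
  apply: continuous_maxr; first exact: cst_continuous.
  move=> s; apply: (@continuous_min _ _ id (cst m)); [exact: cvg_id|exact: cvg_cst].
pose phi s := (ilnprod k (clamp s))^-1.
have phi0 s : 0 < phi s by rewrite invr_gt0 ilnprod_gt0.
have cphi : continuous phi.
  move=> s; apply: cvgV; first by rewrite gt_eqF // ilnprod_gt0.
  apply: (@continuous_comp _ _ _ clamp (ilnprod k)); first exact: cclamp.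
  exact: continuous_ilnprod.
have [G [G0 dG]] := ex_primitive phi lam cphi.
exists phi, G; split => // s lsm.
have /andP[ls sm] := lsm.
split; first by rewrite /phi clampE.
(* On [lam, m] the weight is minus the derivative of the iterated logarithm, so this sum is constant
   there. *)
have dD t : lam <= t <= s -> is_derive t (1 : R) (fun t => G t + iln k.+1 t) 0.
  move=> /andP[lt ts].
  have tm : 0 < t <= m by rewrite (lt_le_trans lam0 lt) (le_trans ts sm).
  apply: (is_derive_eq (@is_deriveD _ _ _ _ _ t 1 _ _ (dG t) (is_derive_iln k t tm (leqnn k)))).
  by rewrite /phi clampE ?subrr // lt (le_trans ts sm).
have [t|t|c _ H] := @MVT_segment R (fun t => G t + iln k.+1 t) (cst 0) lam s ls.
- by move=> tls; apply: dD; rewrite !ltW ?(itvP tls).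
- apply: derivable_within_continuous => u uls.
  by case: (dD u _) => //; rewrite (itvP uls).
move/eqP: H; rewrite mul0r G0 add0r subr_eq0 => /eqP <-.
by rewrite addrK.
Qed.

End Iterated_logarithms.

(** * The limit of the level integrals *)

Lemma cvg_component {R : realType} (v : 'rV[R]_3 -> 'rV[R]_3) j :
  v x @[x --> at_infty] --> (0 : 'rV[R]_3) -> component v j x @[x --> at_infty] --> (0 : R).
Proof.
move=> v0; have := continuous_cvg _ (@coord_continuous _ _ _ 0 j (0 : 'rV[R]_3)) v0.
by rewrite mxE; exact.
Qed.

Section Head_pressure.
Context {R : realType}.
Variables (v : 'rV[R]_3 -> 'rV[R]_3) (p : 'rV[R]_3 -> R) (pbar : R).
Hypothesis v_smooth : smooth_field v.
Hypothesis p_smooth : smooth p.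
Hypothesis NS : stationary_navier_stokes v p.
Hypothesis v_decay : v x @[x --> at_infty] --> (0 : 'rV[R]_3).
Hypothesis v_dirichlet : (integral3 [set: 'rV[R]_3] (sqnorm_grad v) < +oo)%E.
Hypothesis p_lim : p x @[x --> at_infty] --> pbar.

Let Q := head_pressure v p pbar.
Let g x := sqnorm (curl v x).
Let P : 'rV[R]_3 -> R := - Q.

Let div0 : forall x, divergence v x = 0. Proof. by case: NS. Qed.
Let cv j : Cn 1 (component v j). Proof. exact: v_smooth. Qed.
Let cQ : Cn 2 Q. Proof. exact: Cn_head_pressure. Qed.
Let cP : Cn 2 P. Proof. exact: CnN. Qed.
Let g_ge0 x : 0 <= g x. Proof. exact: sqnorm_ge0. Qed.

Lemma head_pressure_cvg0 : Q x @[x --> at_infty] --> (0 : R).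
Proof.
have s0 : (\sum_j component v j * component v j) x @[x --> at_infty] --> (0 : R).
  rewrite sum_ord3.
  have E : 0 * 0 + 0 * 0 + 0 * 0 = 0 :> R by rewrite mul0r !addr0.
  have H j := cvg_component _ j v_decay.
  rewrite -[X in _ --> X]E.
  exact: cvgD (cvgD (cvgM (H 0) (H 0)) (cvgM (H 1) (H 1))) (cvgM (H 2) (H 2)).
rewrite /Q head_pressureE.
have E : 2^-1 * 0 + pbar + - pbar = 0 :> R by rewrite mulr0 add0r subrr.
rewrite -[X in _ --> X]E.
exact: cvgD (cvgD (cvgM (cvg_cst _) s0) p_lim) (cvg_cst _).
Qed.

Let driftQ x : drift Q v x = g x.
Proof. by apply: drift_head_pressure => //; case: NS. Qed.

Lemma head_pressure_le0 x : Q x <= 0.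
Proof.
apply: (subsolution_le0 Q v cQ cv div0 head_pressure_cvg0) => y.
by rewrite driftQ.
Qed.

Lemma curl_eq0_at_max x : Q x = 0 -> g x = 0.
Proof.
move=> Qx; apply/eqP; rewrite eq_le g_ge0 andbT -driftQ.
by apply: drift_max_le0 => // y; rewrite Qx head_pressure_le0.
Qed.

Lemma curl_free_eq0 : (forall x, g x = 0) -> forall x, v x = 0.
Proof.
move=> g0 x; have curl0 y : curl v y = 0 by exact: sqnorm_eq0 (g0 y).
(* With the zero field, [drift] is the Laplacian, so the maximum principle applies to each component
   and to its opposite. *)
pose w0 (_ : 'rV[R]_3) : 'rV[R]_3 := 0.
have w0E j : component w0 j = cst 0 by apply/funext => y; rewrite /component mxE.
have cw0 j : Cn 1 (component w0 j) by rewrite w0E; exact: Cn_cst.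
have dw0 y : divergence w0 y = 0.
  by rewrite /divergence big1 // => j _; rewrite w0E partial_cst.
have dr0 j y : drift (component v j) w0 y = 0.
  rewrite /drift (curl_free_laplacian _ v_smooth div0 _ _ curl0) big1 ?subr0 // => i _.
  by rewrite mxE mul0r.
have cv2 j : Cn 2 (component v j) by exact: v_smooth.
have le0 j y : component v j y <= 0.
  apply: (subsolution_le0 _ w0 (cv2 j) cw0 dw0 (cvg_component _ j v_decay)) => z.
  by rewrite dr0.
have ge0 j y : - component v j y <= 0.
  apply: (subsolution_le0 (- component v j) w0 (CnN _ _ (cv2 j)) cw0 dw0) => [|z].
    by rewrite -[X in _ --> X]oppr0; apply: cvgN; exact: cvg_component.
  by rewrite (driftN _ w0 z (cv2 j)) (dr0 j z) oppr0.
apply/rowP => j; rewrite mxE; apply/eqP; rewrite eq_le.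
have /= -> := le0 j x; have := ge0 j x.
by rewrite oppr_le0.
Qed.

Lemma continuous_sqnorm_curl : continuous g.
Proof.
rewrite (_ : g = drift Q v); last by apply/funext => x; rewrite driftQ.
exact: continuous_drift.
Qed.

Lemma integrable_sqnorm_curl :
  lebesgue_measure3.-integrable setT (fun t => (g (vec3_of t))%:E).
Proof.
have mg : measurable_fun setT (fun t => (g (vec3_of t))%:E).
  by apply/measurable_EFinP; apply: continuous_measurable3; exact: continuous_sqnorm_curl.
have cG : continuous (sqnorm_grad v).
  apply: continuous_sum => i; apply: continuous_sum => j.
  rewrite (_ : (fun _ => _) = (fun x => partial i (component v j) x * partial i (component v j) x)).
    by apply: continuous_mul; exact: (Cn_continuous _ _ (Cn_partial _ _ _ (cv j))).
  by apply/funext => x; rewrite expr2.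
have G0 x : 0 <= sqnorm_grad v x.
  by apply: sumr_ge0 => i _; apply: sumr_ge0 => j _; exact: sqr_ge0.
have mG : measurable_fun setT (fun t => (sqnorm_grad v (vec3_of t))%:E).
  by apply/measurable_EFinP; exact: continuous_measurable3.
have iG : lebesgue_measure3.-integrable setT (fun t => (sqnorm_grad v (vec3_of t))%:E).
  apply/integrableP; split => //; move: v_dirichlet; rewrite /integral3 preimage_setT.
  congr (_ < _)%E; apply: eq_integral => t _; rewrite gee0_abs //= lee_fin //.
have i2G := integrableZl measurableT 2 iG.
apply: le_integrable i2G => // t _.
rewrite -EFinM !gee0_abs ?lee_fin ?mulr_ge0 //.
exact: sqnorm_curl_le.
Qed.

Lemma integral_sqnorm_curl_fin : integral3 setT g \is a fin_num.
Proof. by rewrite /integral3 preimage_setT; exact: integrable_fin_num integrable_sqnorm_curl. Qed.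

(** Makes [inf (range Q)] a genuine lower bound: [Q] is bounded on a box by continuity and by 1
    outside it. *)
Lemma head_pressure_lbound : has_lbound (range Q).
Proof.
have [M M0 QM] := at_infty_box Q 1 head_pressure_cvg0 ltr01.
have [C HC] := continuous_bounded_box Q M (Cn_continuous _ _ cQ) M0.
exists (- Num.max C 1) => _ [x _ <-]; rewrite lerNl.
have Cx : `|Q x| <= Num.max C 1.
  have [/HC xM|/QM/ltW xM] := pselect (box M x); rewrite le_max xM ?orbT //.
by rewrite (le_trans _ Cx) // -normrN ler_norm.
Qed.

(** * The limit when the head pressure is not identically zero *)

Section Nontrivial.
Variable x0 : 'rV[R]_3.
Hypothesis Qx0 : Q x0 < 0.
Variable k : nat.

Let m := `|inf (range Q)|.

Let inf_le x : inf (range Q) <= Q x.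
Proof. by apply: ge_inf; [exact: head_pressure_lbound|exists x]. Qed.

Let inf_lt0 : inf (range Q) < 0. Proof. exact: le_lt_trans (inf_le x0) Qx0. Qed.

Let m_gt0 : 0 < m. Proof. by rewrite normr_gt0 lt_eqF. Qed.

Let P_le x : P x <= m.
Proof. by rewrite /m ltr0_norm // lerN2. Qed.

Let P_ge0 x : 0 <= P x. Proof. by rewrite oppr_ge0 head_pressure_le0. Qed.

Let absQ x : `|Q x| = P x. Proof. by rewrite ler0_norm ?head_pressure_le0. Qed.

Let L := iln k m k.+1.
Let ell (lam : R) := iterlog k.+1 lam^-1.

Definition level_density lam x := if lam < P x then (L lam - L (P x)) * g x else 0.

(** The primitive [G] vanishes at [lam] and increases, so the truncation is a positive part, hence
    continuous. The upper bound holds because [L (P x) >= 0], as [P x <= m]. *)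
Lemma level_densityP lam : 0 < lam <= m ->
  [/\ continuous (level_density lam), forall x, 0 <= level_density lam x <= L lam * g x &
    level_integral k Q lam = integral3 setT (level_density lam)].
Proof.
move=> /[dup] lamm /andP[lam0 lamm'].
have [phi [G [cphi phi0 dG G0 EG]]] := ex_level_weight k m m_gt0 lam lamm.
have drP x : drift P v x = - g x by rewrite (driftN _ v x cQ) driftQ.
have P0 : P x @[x --> at_infty] --> (0 : R).
  by rewrite -[X in _ --> X]oppr0; apply: cvgN; exact: head_pressure_cvg0.
have Pm x : lam < P x -> lam <= P x <= m by move=> /ltW ->; rewrite P_le.
have FE : level_density lam = fun x => Num.max (G (P x)) 0 * g x.
  apply/funext => x; rewrite /level_density; case: ifPn => [lP|].
    have [_ GE] := EG _ (Pm _ lP).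
    rewrite (max_idPl _) ?GE // -GE ltW //.
    by rewrite (primitive_gt0 lam phi G phi0 dG G0).
  rewrite -(primitive_gt0 lam phi G phi0 dG G0) -leNgt => G_le0.
  by rewrite (max_idPr G_le0) mul0r.
split.
- rewrite FE; apply: continuous_mul; last exact: continuous_sqnorm_curl.
  apply: continuous_maxr; last exact: cst_continuous.
  apply: continuous_comp1; first exact: (Cn_continuous _ _ cP).
  exact: is_derive_continuous dG.
- move=> x; apply/andP; split; first by rewrite FE mulr_ge0 // le_max lexx orbT.
  rewrite /level_density; case: ifPn => [lP|_].
    rewrite ler_wpM2r // gerBl; apply: iln_last_ge0 => //.
    by rewrite (lt_trans lam0 lP) P_le.
  by rewrite mulr_ge0 // iln_last_ge0.
- rewrite FE -(level_energy P g v lam phi G cP cv div0 P0 lam0 cphi phi0 dG G0 drP g_ge0).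
  rewrite /level_integral /integral3.
  have -> : [set x | lam < `|Q x|] = [set x | lam < P x].
    by apply/seteqP; split => x /=; rewrite absQ.
  apply: eq_integral => t; rewrite inE /= => lP; congr (_%:E).
  have [-> _] := EG _ (Pm _ lP).
  rewrite [RHS]mulrC (sqnorm_gradN Q (vec3_of t) (CnW _ _ cQ)) /ilnprod.
  by rewrite (absQ (vec3_of t)).
Qed.

Let ell_cvg : ell lam @[lam --> 0^'+] --> +oo.
Proof.
have H : lam^-1 @[lam --> (0 : R)^'+] --> +oo.
  apply/cvgrVy; last by apply: cvg_at_right_filter; exact: cvg_id.
  by near=> x; near: x; exact: nbhs_right_gt.
exact: cvgy_iter_ln k.+1 _ H.
Unshelve. all: by end_near. Qed.

Let ratio_cvg : L lam / ell lam @[lam --> 0^'+] --> (1 : R).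
Proof.
have H : lam^-1 @[lam --> (0 : R)^'+] --> +oo.
  apply/cvgrVy; last by apply: cvg_at_right_filter; exact: cvg_id.
  by near=> x; near: x; exact: nbhs_right_gt.
apply: (cvg_iter_ln_ratio _ k (tower k * m) _ _ H).
by rewrite mulr_gt0 // (lt_le_trans _ (tower_ge1 k)).
Unshelve. all: by end_near. Qed.

(** Levels small enough for domination by [2 * g]; any constant above 1, the limit of the ratio,
    would serve as well as 2. *)
Let good lam := [&& 0 < lam, lam <= m, 0 < ell lam & L lam / ell lam <= 2].

Let near_good : \forall lam \near 0^'+, good lam.
Proof.
near=> lam; apply/and4P; split; near: lam.
- exact: nbhs_right_gt.
- exact: nbhs_right_le.
- by move/cvgryPgt : ell_cvg => /(_ 0).
- have /cvgr_le := ratio_cvg; apply; by rewrite ltr1n.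
Unshelve. all: by end_near. Qed.

(** Where P > 0, L(lam) / ell(lam) tends to 1 and the fixed number L(P x) is divided by a quantity
    tending to infinity. Where P = 0 the density is 0 at every level, and so is [g x], since [x] is
    a maximum point of [Q]. *)
Lemma cvg_level_density x :
  (ell lam)^-1 * level_density lam x @[lam --> 0^'+] --> g x.
Proof.
have [Px|Px] := eqVneq (P x) 0.
  rewrite curl_eq0_at_max; last by apply/eqP; rewrite -oppr_eq0; apply/eqP.
  have c0 : (fun _ : R => 0 : R) lam @[lam --> 0^'+] --> (0 : R) by exact: cvg_cst.
  apply: cvg_trans c0; apply: near_eq_cvg; near=> lam.
  have lam0 : 0 < lam by near: lam; exact: nbhs_right_gt.
  by rewrite /level_density Px ltNge (ltW lam0) /= mulr0.
have P0 : 0 < P x by rewrite lt_neqAle eq_sym Px P_ge0.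
have iell : (ell lam)^-1 @[lam --> 0^'+] --> (0 : R).
  have pos : \forall lam \near 0^'+, 0 < ell lam by move/cvgryPgt : ell_cvg => /(_ 0).
  exact/(gtr0_cvgV0 pos).
have C : (L lam / ell lam - L (P x) * (ell lam)^-1) * g x @[lam --> 0^'+] --> g x.
  have E : (1 - L (P x) * 0) * g x = g x by rewrite mulr0 subr0 mul1r.
  rewrite -[X in _ --> X]E.
  exact: cvgM (cvgB ratio_cvg (cvgM (cvg_cst _) iell)) (cvg_cst _).
apply: cvg_trans C; apply: near_eq_cvg; near=> lam.
have lP : lam < P x by near: lam; exact: nbhs_right_lt.
rewrite /level_density lP.
by rewrite -mulrBl mulrA [in RHS](mulrC (ell lam)^-1).
Unshelve. all: by end_near. Qed.

(** Dominated convergence concerns sequences, so the limit is tested along an arbitrary sequence of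
    positive levels tending to 0. *)
Theorem level_integral_cvg_nontrivial :
  ((ell lam)^-1%:E * level_integral k Q lam)%E @[lam --> 0^'+] --> integral3 setT g.
Proof.
rewrite -(fineK integral_sqnorm_curl_fin); apply/cvge_at_rightP => u [u0 ucvg].
rewrite fineK; last exact: integral_sqnorm_curl_fin.
have uF : u n @[n --> \oo] --> (0 : R)^'+.
  move=> A /= [e /= e0 eA]; have /cvgrPdist_lt /(_ e e0) := ucvg.
  by apply: filterS => n un; apply: eA => //; exact: u0.
(* Finitely many levels may fail to be good; the value 0 there makes measurability and domination
   hold for every [n]. *)
pose f n : 'rV[R]_3 -> R :=
  if good (u n) then fun x => (ell (u n))^-1 * level_density (u n) x else cst 0.
have goodu : \forall n \near \oo, good (u n) by exact: uF near_good.
have cf n : continuous (f n).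
  rewrite /f; case: ifPn => [/and4P[l0 lm _ _]|_]; last exact: cst_continuous.
  have lm01 : 0 < u n <= m by rewrite l0.
  have [cl _ _] := level_densityP (u n) lm01.
  by apply: continuous_mul => //; exact: cst_continuous.
have f0 n x : 0 <= f n x.
  rewrite /f; case: ifPn => // /and4P[l0 lm ell0 _].
  have lm01 : 0 < u n <= m by rewrite l0.
  have [_ /(_ x)/andP[? _] _] := level_densityP (u n) lm01.
  by rewrite mulr_ge0 // invr_ge0 ltW.
have fg n x : f n x <= 2 * g x.
  rewrite /f; case: ifPn => [/and4P[l0 lm ell0 L2]|_]; last by rewrite mulr_ge0.
  have lm01 : 0 < u n <= m by rewrite l0.
  have [_ /(_ x)/andP[_ le] _] := level_densityP (u n) lm01.
  have ie0 : 0 <= (ell (u n))^-1 by rewrite invr_ge0 ltW.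
  apply: (le_trans (ler_wpM2l ie0 le)).
  by rewrite mulrA (mulrC (ell (u n))^-1); exact: ler_wpM2r.
have mf n : measurable_fun setT (fun t => (f n (vec3_of t))%:E).
  by apply/measurable_EFinP; exact: continuous_measurable3.
have mg : measurable_fun setT (fun t => (g (vec3_of t))%:E).
  by apply/measurable_EFinP; apply: continuous_measurable3; exact: continuous_sqnorm_curl.
have i2g := integrableZl measurableT 2 integrable_sqnorm_curl.
have [||_ _ D] := @dominated_convergence _ _ R lebesgue_measure3 setT measurableT
  (fun n t => (f n (vec3_of t))%:E) (fun t => (g (vec3_of t))%:E) _ mf mg _ i2g.
- apply: aeW => t _; apply: cvg_EFin; first exact: nearW.
  have C := cvg_comp _ _ uF (cvg_level_density (vec3_of t)).
  apply: cvg_trans C; apply: near_eq_cvg.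
  by apply: filterS goodu => n gn /=; rewrite /f gn.
- apply: aeW => t n _; rewrite -EFinM gee0_abs ?lee_fin //.
have {}D : integral3 setT (f n) @[n --> \oo] --> integral3 setT g.
  by rewrite /integral3 preimage_setT; exact: D.
apply: cvg_trans D; apply: near_eq_cvg; apply: filterS goodu => n gn.
have /and4P[l0 lm ell0 _] := gn.
have lm01 : 0 < u n <= m by rewrite l0.
  have [cl l_ge0 ->] := level_densityP (u n) lm01.
rewrite /f gn /integral3 preimage_setT -ge0_integralZl_EFin //.
- by move=> t _; rewrite lee_fin; case/andP: (l_ge0 (vec3_of t)).
- by apply/measurable_EFinP; exact: continuous_measurable3.
- by rewrite invr_ge0 ltW.
Qed.

End Nontrivial.

(** If [Q] vanishes identically then m = 0 and the weight has no meaning, but the level sets are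
    empty and every point is a maximum of [Q], so both sides are 0. *)
Theorem level_integral_cvg k :
  ((iterlog k.+1 lam^-1)^-1%:E * level_integral k Q lam)%E @[lam --> 0^'+] -->
    integral3 setT g.
Proof.
have [[x0 Qx0]|Q0] := pselect (exists x0, Q x0 < 0).
  exact: level_integral_cvg_nontrivial Qx0 k.
have {}Q0 x : Q x = 0.
  apply/eqP; rewrite eq_le head_pressure_le0 /= leNgt; apply/negP => Qx.
  by apply: Q0; exists x.
have -> : integral3 setT g = 0%E.
  by apply: integral0_eq => t _; rewrite curl_eq0_at_max.
have c0 : (fun _ : R => 0%E : \bar R) lam @[lam --> 0^'+] --> (0 : \bar R)%E by exact: cvg_cst.
apply: cvg_trans c0; apply: near_eq_cvg; near=> lam.
rewrite /level_integral /integral3 (_ : [set x | _] = set0).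
  by rewrite preimage_set0 integral_set0 mule0.
have lam0 : 0 < lam by near: lam; exact: nbhs_right_gt.
apply/seteqP; split => // x /=; rewrite Q0 normr0; apply/negP.
by rewrite -leNgt (ltW lam0).
Unshelve. all: by end_near. Qed.

Theorem liouville k :
  (fun lam : R => fine (level_integral k Q lam)) =o_ (0^'+)
    (fun lam : R => iterlog k.+1 lam^-1) -> forall x, v x = 0.
Proof.
move=> /eqoP lo; apply: curl_free_eq0.
apply: continuous_integral3_eq0 => //; first exact: continuous_sqnorm_curl.
have := level_integral_cvg k; rewrite -(fineK integral_sqnorm_curl_fin).
move=> /fine_cvgP[_ H]; congr (_%:E).
have Z : fine ((iterlog k.+1 lam^-1)^-1%:E * level_integral k Q lam)%E @[lam --> 0^'+]
    --> (0 : R).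
  apply/cvgr0Pnorm_le => e e0; near=> lam.
  have le : `|fine (level_integral k Q lam)| <= e * `|iterlog k.+1 lam^-1|.
    by near: lam; exact: lo.
  (* Where the iterated logarithm is 0, its inverse is 0 by convention and so is the product. *)
  have [->|l0] := eqVneq (iterlog k.+1 lam^-1) 0.
    by rewrite invr0 mul0e normr0 ltW.
  (* A nonzero factor keeps an infinite value infinite, and [fine] sends both infinities to 0, so
     [fine] commutes with this product. *)
  have -> : fine ((iterlog k.+1 lam^-1)^-1%:E * level_integral k Q lam)%E =
      (iterlog k.+1 lam^-1)^-1 * fine (level_integral k Q lam).
    have i0 : (iterlog k.+1 lam^-1)^-1 != 0 by rewrite invr_eq0.
    case: (level_integral k Q lam) => [r| |] //=.
      rewrite mulr0; have [i1|i1|i1] := ltgtP (iterlog k.+1 lam^-1)^-1 0.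
      - by rewrite lt0_muley ?lte_fin.
      - by rewrite gt0_muley ?lte_fin.
      - by rewrite i1 eqxx in i0.
    rewrite mulr0; have [i1|i1|i1] := ltgtP (iterlog k.+1 lam^-1)^-1 0.
    - by rewrite lt0_muleNy ?lte_fin.
    - by rewrite gt0_muleNy ?lte_fin.
    - by rewrite i1 eqxx in i0.
  by rewrite normrM normfV ler_pdivrMl ?normr_gt0 // mulrC.
exact: cvg_unique H Z.
Unshelve. all: by end_near. Qed.

End Head_pressure.

Theorem theorem1p1 (R : realType)
    (v : 'rV[R]_3 -> 'rV[R]_3) (p : 'rV[R]_3 -> R) (pbar : R)
    (v_smooth : smooth_field v) (p_smooth : smooth p)
    (v_p_NS : stationary_navier_stokes v p)
    (v_decay : v x @[x --> at_infty] --> (0 : 'rV[R]_3))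
    (v_dirichlet : (integral3 [set: 'rV[R]_3] (sqnorm_grad v) < +oo)%E)
    (p_lim : p x @[x --> at_infty] --> pbar) :
  let Q := head_pressure v p pbar in
  (forall k : nat,
    ((iterlog k.+1 lambda^-1)^-1%:E * level_integral k Q lambda)%E
      @[lambda --> 0^'+] -->
    integral3 [set: 'rV[R]_3] (fun x => sqnorm (curl v x))) /\
  ((exists k : nat,
      (fun lambda : R => fine (level_integral k Q lambda)) =o_ (0^'+)
      (fun lambda : R => iterlog k.+1 lambda^-1)) ->
   forall x, v x = 0).
Proof.
move=> Q; split=> [k|[k]].
  exact: level_integral_cvg.
exact: liouville.
Qed.
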